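(* Let $\Omega\subset\mathbb{R}^2$ be a convex body (compact convex set with non-empty interior) with piecewise $C^1$ boundary which is axially symmetric, i.e. invariant under the reflection in some line. Then for every $\alpha$ with $1<\alpha<3$, $\Omega$ has a unique $r^{\alpha-2}$-center.
   Context: For $\alpha>0$ and $x\in\mathbb{R}^2$, with $r=|y-x|$: $V_\Omega^{(\alpha)}(x)=\int_\Omega r^{\alpha-2}\,dy$ if $\alpha\ne 2$, and $V_\Omega^{(2)}(x)=-\int_\Omega\log r\,dy$. A point $x\in\mathbb{R}^2$ is an $r^{\alpha-2}$-center of $\Omega$ if it attains the maximum of $V_\Omega^{(\alpha)}$ over $\mathbb{R}^2$ when $0<\alpha\le 2$, or the minimum of $V_\Omega^{(\alpha)}$ over $\mathbb{R}^2$ when $\alpha>2$. *)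

(* Defs.v *)
From Stdlib Require Import Reals Lra ClassicalEpsilon.
Open Scope R_scope.

Definition pt := (R * R)%type.

Definition dist2 (p q : pt) : R :=
  sqrt ((fst p - fst q) ^ 2 + (snd p - snd q) ^ 2).

Definition convex_set (O : pt -> Prop) : Prop :=
  forall p q t, O p -> O q -> 0 <= t <= 1 ->
    O (t * fst p + (1 - t) * fst q, t * snd p + (1 - t) * snd q).

Definition interior_pt (O : pt -> Prop) (p : pt) : Prop :=
  exists e, 0 < e /\ forall q, dist2 p q < e -> O q.

Definition closed_set (O : pt -> Prop) : Prop :=
  forall p, ~ O p -> exists e, 0 < e /\ forall q, dist2 p q < e -> ~ O q.

Definition bounded_set (O : pt -> Prop) : Prop :=
  exists M, forall p, O p -> dist2 p (0, 0) <= M.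

Definition convex_body (O : pt -> Prop) : Prop :=
  convex_set O /\ closed_set O /\ bounded_set O /\ exists p, interior_pt O p.

Definition boundary_pt (O : pt -> Prop) (p : pt) : Prop :=
  O p /\ ~ interior_pt O p.   (* O is closed *)

Definition regular_C1 (g1 g2 : R -> R) : Prop :=
  exists d1 d2 : R -> R,
    (forall s, derivable_pt_lim g1 s (d1 s)) /\
    (forall s, derivable_pt_lim g2 s (d2 s)) /\
    continuity d1 /\ continuity d2 /\
    (forall s, d1 s <> 0 \/ d2 s <> 0).

Definition piecewise_C1_boundary (O : pt -> Prop) : Prop :=
  exists (gamma : R -> pt) (k : nat) (t : nat -> R),
    t 0%nat = 0 /\ t k = 1 /\ (0 < k)%nat /\
    (forall i, (i < k)%nat -> t i < t (S i)) /\
    gamma 0 = gamma 1 /\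
    (forall s u, 0 <= s < 1 -> 0 <= u < 1 -> gamma s = gamma u -> s = u) /\
    (forall p, boundary_pt O p <-> exists s, 0 <= s <= 1 /\ gamma s = p) /\
    (forall i, (i < k)%nat ->
       exists g1 g2 : R -> R, regular_C1 g1 g2 /\
         forall s, t i <= s <= t (S i) -> gamma s = (g1 s, g2 s)).

(* reflection in the line through p0 with direction (cos th, sin th) *)
Definition reflect (p0 : pt) (th : R) (p : pt) : pt :=
  let a := fst p - fst p0 in
  let b := snd p - snd p0 in
  let c := a * cos th + b * sin th in
  (fst p0 + 2 * c * cos th - a, snd p0 + 2 * c * sin th - b).

Definition axially_symmetric (O : pt -> Prop) : Prop :=
  exists p0 th, forall p, O p <-> O (reflect p0 th p).

Fixpoint sumN (n : nat) (f : nat -> R) : R :=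
  match n with
  | O => 0
  | S m => sumN m f + f m
  end.

Definition in_cell (R0 : R) (n i j : nat) (p : pt) : Prop :=
  let h := 2 * R0 / INR n in
  - R0 + INR i * h <= fst p <= - R0 + INR (S i) * h /\
  - R0 + INR j * h <= snd p <= - R0 + INR (S j) * h.

Definition square_integral (g : pt -> R) (R0 v : R) : Prop :=
  forall eps, 0 < eps -> exists N : nat, forall n : nat, (N <= n)%nat -> (0 < n)%nat ->
    forall tag : nat -> nat -> pt,
      (forall i j, (i < n)%nat -> (j < n)%nat -> in_cell R0 n i j (tag i j)) ->
      Rabs (sumN n (fun i => sumN n (fun j => g (tag i j)))
              * ((2 * R0 / INR n) * (2 * R0 / INR n)) - v) < eps.

(* (Improper Riemann) integral of f (bounded below on O) over the bounded set
   O equals v: limit as M -> +oo of the Riemann integrals of min(f, M) 1_O. *)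
Definition integral_over (O : pt -> Prop) (f : pt -> R) (v : R) : Prop :=
  exists R0, 0 < R0 /\
    (forall y, O y -> Rabs (fst y) < R0 /\ Rabs (snd y) < R0) /\
    exists I : R -> R,
      (forall M, square_integral
         (fun y => if excluded_middle_informative (O y) then Rmin (f y) M else 0)
         R0 (I M)) /\
      (forall eps, 0 < eps -> exists M0, forall M, M0 <= M -> Rabs (I M - v) < eps).

Definition kernel (alpha : R) (x y : pt) : R :=
  if Req_dec_T alpha 2 then - ln (dist2 y x) else Rpower (dist2 y x) (alpha - 2).

Definition V_is (O : pt -> Prop) (alpha : R) (x : pt) (v : R) : Prop :=
  integral_over O (kernel alpha x) v.

Definition is_center (O : pt -> Prop) (alpha : R) (x : pt) : Prop :=
  exists v, V_is O alpha x v /\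
    forall y w, V_is O alpha y w ->
      (alpha <= 2 -> w <= v) /\ (2 < alpha -> v <= w).

(* Main.v *)
(* Read the centers off the Lebesgue potential W of a decreasing kernel, the line of symmetry
   being the first axis after a rotation.

   Reflecting in a line parallel to the axis shows that W is larger on the axis than off it, and
   outside the body W decreases along the axis. Along the axis inside the body W has no local
   minimum, which gives uniqueness: between two maxima there would be one. Indeed, from an
   interior axis point y draw the two rays with directions (-eta, 1) and (eta, 1), leaving the
   body at P and P'. Let Phi be the homothety with center on the axis (or the translation along
   it) mapping P to P', and q1 the axis point with Phi q1 = y. By concavity of the profile of the
   body, Phi^-1 of the body is smaller than the body to the right of P and larger to its left;
   to the right the kernel is larger at y than at q1, to the left smaller. Hence by scaling
   W(Phi y) - W(y) is less than a positive multiple of W(y) - W(q1), so W(y) is not less than or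
   equal to both W(q1) and W(Phi y), and these two points are close to y when eta is small.

   The integral is the one for the product Lebesgue measure. Improper Riemann integrability
   holds because the kernel is O(1/r) near its singularity and the boundary of a convex
   body is a null set. *)
Require Import Defs.
From Stdlib Require Import Reals Lra Lia ClassicalEpsilon.
From HB Require Import structures.
From mathcomp Require Import all_boot all_order all_algebra.
From mathcomp Require Import all_classical all_reals all_analysis.
From mathcomp Require Import measurable_realfun Rstruct Rstruct_topology.
From mathcomp Require lra ring.
Set Implicit Arguments.
Unset Strict Implicit.
Unset Printing Implicit Defensive.
Import Order.TTheory GRing.Theory Num.Theory numFieldNormedType.Exports.

(** The potential is never differentiated. Only its values at two points are compared, each time
    through the integral of [kdiff], whose sign is read off the perpendicular bisector of the two
    points. Working with differences also puts the logarithm on the same footing as the powers,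
    because the additive constant produced by scaling cancels. The condition 1 < alpha < 3 says that
    the exponent lies strictly between -1 and 1. This keeps the kernel below 1/r + r in absolute
    value, hence integrable near its singularity, with one dominating function for all centers in a
    bounded region. The kernel has an arbitrary value at distance 0, so inequalities between
    integrands hold only off a null set. Strictness therefore comes from a small ball on which the
    integrand is positive, and each comparison has to exhibit such a ball. *)

Section PlaneMeasure.
Import mathcomp.algebra_tactics.lra mathcomp.algebra_tactics.ring.
Local Open Scope classical_set_scope.
Local Open Scope ring_scope.
Context {R : realType}.

Notation RR := (measurableTypeR R).
Notation leb := (@lebesgue_measure R).

(** * Product Lebesgue measure, and areas under swaps and shears *)

Definition mu2 := (leb \x leb)%E.
HB.instance Definition _ := Measure.on mu2.

Lemma measurable_affine (a k : R) : measurable_fun setT (fun y : RR => (a + k * y)%R : RR).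
Proof.
apply: measurable_funD => //; apply: measurable_funM => //.
Qed.

(** By uniqueness of Lebesgue measure: [|k|] times the pushforward agrees with [leb] on half-open
    intervals. A negative k exchanges the open and the closed end of the preimage, which leaves the
    length unchanged. *)
Lemma lebesgue_affine (a k : R) (A : set RR) : k != 0 -> measurable A ->
  leb [set y | A (a + k * y)] = (`|k|^-1%:E * leb A)%E.
Proof.
move=> k0 mA.
have mT := measurable_affine a k.
have nk0 : (0 <= `|k|)%R by [].
pose m := (mscale (NngNum nk0) (measure_function_pushforward__canonical__measure_function_Measure leb mT)).
have mE B : m B = (`|k|%:E * leb [set y | B (a + k * y)%R])%E by [].
have -> : leb A = m A.
  apply: (@lebesgue_measure_unique R m) => // X [[u v] _ /= <-].
  rewrite -[RHS]/(m _) mE.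
  have [kp|kn|/eqP] := ltgtP 0 k; last by rewrite eq_sym (negbTE k0).
    rewrite (_ : [set y : RR | _ (a + k * y)] = `](u - a) / k, (v - a) / k]%classic); last first.
      apply/seteqP; split=> y /=; rewrite !in_itv/= ltr_pdivrMr// ler_pdivlMr//;
        rewrite ltrBlDl lerBrDl mulrC//.
    rewrite !lebesgue_measure_itv/= !lte_fin ltr_pM2r ?invr_gt0// ltrD2r.
    case: ifP => _; rewrite ?mule0//.
    rewrite gtr0_norm// -!EFinB -EFinM; congr EFin.
    by field.
  rewrite (_ : [set y : RR | _ (a + k * y)] = `[(v - a) / k, (u - a) / k[%classic); last first.
    apply/seteqP; split=> y /=; rewrite !in_itv/= ltr_ndivlMr// ler_ndivrMr//;
      rewrite ltrBlDl lerBrDl mulrC andbC//.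
  rewrite !lebesgue_measure_itv/= !lte_fin ltr_nM2r ?invr_lt0// ltrD2r.
  case: ifP => _; rewrite ?mule0//.
  rewrite ltr0_norm// -!EFinB -EFinM; congr EFin.
  by field.
rewrite mE muleA -EFinM mulVf ?mul1e// normr_eq0//.
Qed.

(* T multiplies areas of preimages by c; for a linear map, c = 1 / |det T|. *)
Definition scales_area (c : R) (T : RR * RR -> RR * RR) : Prop :=
  [/\ measurable_fun setT T, 0 <= c &
  forall A : set (RR * RR), measurable A ->
    mu2 [set p | A (T p)] = (c%:E * mu2 A)%E].

Lemma scales_area_comp c d S T :
  scales_area c S -> scales_area d T -> scales_area (d * c) (S \o T).
Proof.
move=> [mS c0 hS] [mT d0 hT]; split.
- exact: measurableT_comp.
- exact: mulr_ge0.
move=> A mA; have := hT (S @^-1` A); rewrite EFinM -muleA -hS//; apply.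
by rewrite -[X in measurable X]setTI; exact: mS.
Qed.

(** The pushforward under the swap has the right values on rectangles, and these determine the
    product measure. *)
Lemma scales_area_swap : scales_area 1 (fun p => (p.2, p.1)).
Proof.
have mswap : measurable_fun setT (fun p : RR * RR => (p.2, p.1)).
  exact: measurable_fun_pair.
split=> // A mA; rewrite mul1e.
pose m := (measure_function_pushforward__canonical__measure_function_Measure mu2 mswap).
have mE B : m B = mu2 [set p | B (p.2, p.1)] by [].
rewrite -mE; apply/esym.
apply: (@product_measure_unique _ _ _ _ R leb leb m) => // X Y mX mY.
rewrite mE (_ : [set p | _] = Y `*` X); last first.
  by apply/seteqP; split=> p /= [].
rewrite /mu2/= product_measure1E// muleC//.
Qed.

Definition shear (k : R) (g : RR -> RR) (p : RR * RR) : RR * RR :=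
  (p.1, g p.1 + k * p.2).

(** On every vertical line the shear is affine with slope k, so all fibres of the preimage of a
    rectangle are scaled by the same factor, whatever [g] is. The translations, diagonal maps and
    rotations of the later sections are assembled from such shears and the swap. *)
Lemma scales_area_shear (k : R) (g : RR -> RR) : k != 0 -> measurable_fun setT g ->
  scales_area `|k|^-1 (shear k g).
Proof.
move=> k0 mg.
have mS : measurable_fun setT (shear k g).
  apply: measurable_fun_pair => //; apply: measurable_funD.
    by apply: measurableT_comp.
  by apply: measurable_funM.
split=> // A mA.
have nk0 : (0 <= `|k|)%R by [].
pose m := mscale (NngNum nk0) (measure_function_pushforward__canonical__measure_function_Measure mu2 mS).
have mE B : m B = (`|k|%:E * mu2 [set p | B (p.1, g p.1 + k * p.2)%R])%E by [].
have -> : mu2 A = m A.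
  apply: (@product_measure_unique _ _ _ _ R leb leb m) => // X Y mX mY.
  rewrite -[LHS]/(m _) mE /mu2/= /product_measure1/=.
  rewrite (eq_integral (fun x => (\1_X x)%:E * (`|k|^-1%:E * leb Y))%E); last first.
    move=> x _; rewrite indicE; have [xX|xX] /= := boolP (x \in X).
      rewrite mul1e -(lebesgue_affine (g x) k0)//; congr (leb _).
      rewrite /xsection; apply/seteqP; split=> y /=; rewrite inE/=; first by case.
      by move: xX; rewrite inE.
    rewrite mul0e (_ : xsection _ _ = set0) ?measure0//.
    rewrite /xsection; apply/seteqP; split=> y //=; rewrite inE/= => -[].
    by move: xX; rewrite notin_setE.
  rewrite ge0_integralZr ?integral_indic ?setIT//; last first.
  - by rewrite mule_ge0// lee_fin invr_ge0.
  - by apply/measurable_EFinP; exact: measurable_indic.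
  by rewrite muleCA (muleA `|k|%:E) -EFinM mulfV ?mul1e// normr_eq0.
rewrite mE muleA -EFinM mulVf ?mul1e// normr_eq0//.
Qed.
End PlaneMeasure.

(** * Integrals over the plane: change of variables, null sets, dominated convergence *)

Section PlaneIntegral.
Local Open Scope classical_set_scope.
Local Open Scope ring_scope.
Context {R : realType}.
Notation RR := (measurableTypeR R).
Notation leb := (@lebesgue_measure R).
Notation mu2 := (@mu2 R).
Implicit Types (f g : RR * RR -> R) (T : RR * RR -> RR * RR).

Definition integ f := mu2.-integrable setT (EFin \o f).
Definition I2 f : R := \int[mu2]_z f z.

Lemma ge0_integral_scales_area c T (f : RR * RR -> \bar R) : scales_area c T ->
  measurable_fun setT f -> (forall x, 0 <= f x)%E ->
  (\int[mu2]_x f (T x) = c%:E * \int[mu2]_x f x)%E.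
Proof.
move=> [mT c0 hT] mf f0.
rewrite -(@ge0_integral_mscale _ _ R mu2 setT _ (NngNum c0))//.
transitivity (\int[pushforward mu2 T]_x f x)%E.
  by rewrite ge0_integral_pushforward// preimage_setT.
apply: (@eq_measure_integral _ _ _ _
  (mscale (NngNum c0) mu2)
  (measure_function_pushforward__canonical__measure_function_Measure mu2 mT)).
by move=> A mA _; first [exact: hT|exact: esym (hT A mA)].
Qed.

Lemma scales_area_integ c T f : scales_area c T -> integ f -> integ (f \o T).
Proof.
move=> hT /integrableP[mf intf]; apply/integrableP; split.
  by case: hT => mT _ _; exact: (measurableT_comp mf).
rewrite (ge0_integral_scales_area (f := fun x => `|(f x)%:E|%E) hT)//.
  by case: hT => _ c0 _; apply: lte_mul_pinfty.
exact: measurableT_comp.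
Qed.

Lemma scales_area_I2 c T f : scales_area c T -> integ f -> I2 (f \o T) = c * I2 f.
Proof.
move=> hT intf.
have intfT := scales_area_integ hT intf.
have mf : measurable_fun setT (EFin \o f) by case/integrableP: intf.
rewrite /I2 /Rintegral.
have -> : (\int[mu2]_x ((f \o T) x)%:E = c%:E * \int[mu2]_x (f x)%:E)%E.
  have E1 : (\int[mu2]_x ((fun x => ((f \o T) x)%:E)^\+ x) =
     c%:E * \int[mu2]_x ((EFin \o f)^\+ x))%E.
    rewrite -(ge0_integral_scales_area hT)//.
      by apply: eq_integral => x _; rewrite !funeposE.
    exact: measurable_funepos.
  have E2 : (\int[mu2]_x ((fun x => ((f \o T) x)%:E)^\- x) =
     c%:E * \int[mu2]_x ((EFin \o f)^\- x))%E.
    rewrite -(ge0_integral_scales_area hT)//.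
      by apply: eq_integral => x _; rewrite !funenegE.
    exact: measurable_funeneg.
  have := integralE mu2 setT (fun x => ((f \o T) x)%:E).
  (* Distributing [c] over a difference of extended reals requires excluding oo - oo; the negative
     part has finite integral. *)
  rewrite E1 E2 -muleBr//; last first.
    by apply: fin_num_adde_defl; rewrite fin_numN; exact: integrable_neg_fin_num.
  by move=> ->; congr (_ * _)%E; rewrite [RHS]integralE.
rewrite fineM//.
exact: integrable_fin_num.
Qed.

Lemma I2D f g : integ f -> integ g -> integ (f \+ g) /\ I2 (f \+ g) = I2 f + I2 g.
Proof.
move=> hf hg; split; last exact: RintegralD.
exact: (integrableD measurableT hf hg).
Qed.

Lemma I2Z k f : integ f -> integ (fun x => k * f x) /\ I2 (fun x => k * f x) = k * I2 f.
Proof.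
move=> hf; split; last exact: RintegralZl.
exact: (integrableZl measurableT k hf).
Qed.

Lemma le_I2 f g : integ f -> integ g -> (forall x, f x <= g x) -> I2 f <= I2 g.
Proof. by move=> hf hg fg; apply: le_Rintegral. Qed.

Lemma le_integ f g : measurable_fun setT f -> integ g ->
  (forall x, `|f x| <= g x) -> integ f.
Proof.
move=> mf hg fg; apply: (le_integrable measurableT _ _ hg).
  exact/measurable_EFinP.
by move=> x _ /=; rewrite lee_fin (le_trans (fg x))// ler_norm.
Qed.

Lemma I2_eq0 f : integ f -> (forall x, 0 <= f x) -> I2 f = 0 ->
  mu2.-negligible [set x | f x != 0].
Proof.
move=> hf f0 If0.
have mf : measurable_fun setT (EFin \o f) by case/integrableP: hf.
have : (\int[mu2]_x `|(EFin \o f) x| = 0)%E.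
  rewrite (eq_integral (EFin \o f)); last by move=> x _; rewrite gee0_abs//= lee_fin.
  rewrite -[LHS]fineK; last exact: integrable_fin_num.
  by rewrite -[fine _]/(I2 f) If0.
move/(ae_eq_integral_abs mu2 measurableT mf).
apply: negligibleS => x /= fx0 /(_ I) /= [] fx; by rewrite fx eqxx in fx0.
Qed.

Lemma null_I2 f : measurable_fun setT f -> mu2.-negligible [set x | f x != 0] ->
  integ f /\ I2 f = 0.
Proof.
move=> mf nf.
have mEf : measurable_fun setT (EFin \o f) by apply/measurable_EFinP.
have h : ae_eq mu2 setT (EFin \o f) (cst 0%E).
  apply: negligibleS nf => x /=; apply: contra_not_neq => fx _ /=; by rewrite fx.
have h0 : (\int[mu2]_x `|(EFin \o f) x| = 0)%E.
  exact/(ae_eq_integral_abs mu2 measurableT mEf).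
split; first by apply/integrableP; split=> //; rewrite h0.
rewrite /I2 /Rintegral (ae_eq_integral (cst 0%E)) ?integral0//.
Qed.

Lemma I2_dct (fn : nat -> RR * RR -> R) f g (N : set (RR * RR)) :
  (forall n, measurable_fun setT (fn n)) -> measurable_fun setT f ->
  mu2.-negligible N ->
  (forall x, ~ N x -> fn ^~ x @ \oo --> f x) ->
  (forall n x, `|fn n x| <= g x) -> integ g ->
  (fun n => I2 (fn n)) @ \oo --> I2 f.
Proof.
move=> mfn mf nN cv fg ig.
have mg : measurable_fun setT (EFin \o g) by case/integrableP: ig.
have [] := @dominated_convergence _ _ R mu2 setT measurableT
  (fun n => EFin \o fn n) (EFin \o f) (EFin \o g).
- by move=> n; apply/measurable_EFinP.
- exact/measurable_EFinP.
- apply: negligibleS nN => x /=; apply: contra_notP => /cv h _.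
  by apply/cvg_EFin => //=; apply: nearW.
- exact: ig.
- by apply: aeW => x n _ /=; rewrite lee_fin.
move=> intf _ h.
have /fine_cvgP[_ hh] : (fun n => \int[mu2]_x (fn n x)%:E)%E @ \oo --> (I2 f)%:E.
  rewrite /I2 /Rintegral fineK//; exact: integrable_fin_num.
exact: hh.
Qed.

End PlaneIntegral.

(** * Boxes, open sets, and integrability of 1/r in the plane *)

Section PlaneSets.
Import mathcomp.algebra_tactics.lra mathcomp.algebra_tactics.ring.
Local Open Scope classical_set_scope.
Local Open Scope ring_scope.
Context {R : realType}.
Notation RR := (measurableTypeR R).
Notation leb := (@lebesgue_measure R).
Notation mu2 := (@mu2 R).
Implicit Types (f g : RR * RR -> R) (T : RR * RR -> RR * RR).

Definition box (a b c d : R) : set (RR * RR) := `[a, b[%classic `*` `[c, d[%classic.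

Lemma measurable_box a b c d : measurable (box a b c d).
Proof. by apply: measurableX; exact: measurable_itv. Qed.

Lemma mu2_box a b c d : a <= b -> c <= d -> mu2 (box a b c d) = ((b - a) * (d - c))%:E.
Proof.
move=> ab cd; rewrite /mu2 /= product_measure1E; try exact: measurable_itv.
have E (x y : R) : x <= y -> leb `[x, y[%classic = (y - x)%:E.
  move=> xy; rewrite lebesgue_measure_itv/= lte_fin; case: ltgtP xy => // ->.
  by rewrite subrr.
by rewrite -[LHS]/(leb _ * leb _)%E !E.
Qed.

Lemma integ_indic_box a b c d : a <= b -> c <= d ->
  integ (\1_(box a b c d) : RR * RR -> R) /\ I2 (\1_(box a b c d) : RR * RR -> R) = (b - a) * (d - c).
Proof.
move=> ab cd.
have E : (\int[mu2]_x (\1_(box a b c d) x)%:E = ((b - a) * (d - c))%:E)%E.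
  by rewrite integral_indic ?setIT//; [exact: mu2_box|exact: measurable_box].
split; last by rewrite /I2 /Rintegral E.
apply/integrableP; split.
  by apply/measurable_EFinP; apply: measurable_indic; exact: measurable_box.
rewrite (eq_integral (fun x => (\1_(box a b c d) x)%:E)) ?E ?ltry//.
by move=> x _; rewrite /= ger0_norm.
Qed.

Lemma box_not_negligible a b c d (N : set (RR * RR)) : a < b -> c < d ->
  mu2.-negligible N -> exists2 x, box a b c d x & ~ N x.
Proof.
move=> ab cd nN; apply: contrapT => h.
have bN : box a b c d `<=` N.
  by move=> x bx; apply: contrapT => nx; apply: h; exists x.
have := measure_negligible (measurable_box a b c d) (negligibleS bN nN).
rewrite -[X in X = _]/(mu2 (box a b c d)) mu2_box ?ltW// => -[] /eqP; rewrite mulf_eq0 !subr_eq0.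
by rewrite (gt_eqF ab) (gt_eqF cd).
Qed.

Lemma negligible_point (p : RR * RR) : mu2.-negligible [set p].
Proof.
exists ([set p.1] `*` [set p.2]); split.
- by apply: measurableX; exact: measurable_set1.
- rewrite /mu2 /= product_measure1E; try exact: measurable_set1.
  by rewrite -[LHS]/(leb _ * leb _)%E lebesgue_measure_set1 mul0e.
- by move=> x -> /=.
Qed.

Definition box_open (U : set (RR * RR)) := forall p, U p -> exists2 e : R, 0 < e &
  forall q : RR * RR, `|q.1 - p.1| < e -> `|q.2 - p.2| < e -> U q.

(** U is the union of the boxes with rational corners that it contains, a countable family; a box
    that leaves U is replaced by [set0]. *)
Lemma box_open_measurable U : box_open U -> measurable U.
Proof.
move=> oU.
pose F (i : rat * rat * rat * rat) : set (RR * RR) := let: (a, b, c, d) := i in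
  if `[< box (ratr a) (ratr b) (ratr c) (ratr d) `<=` U >]
  then box (ratr a) (ratr b) (ratr c) (ratr d) else set0.
have -> : U = \bigcup_i F i.
  apply/seteqP; split=> [p Up|p [[[[a b] c] d] _]]; last first.
    by rewrite /F; case: asboolP => // h; exact: h.
  have [e e0 he] := oU _ Up.
  have between (x y : R) : x < y -> exists q : rat, x < ratr q < y.
    by move=> /rat_in_itvoo[q]; rewrite in_itv/=; exists q.
  have [|a /andP[a1 a2]] := between (p.1 - e) p.1; first by rewrite ltrBlDr ltrDl.
  have [|b /andP[b1 b2]] := between p.1 (p.1 + e); first by rewrite ltrDl.
  have [|c /andP[c1 c2]] := between (p.2 - e) p.2; first by rewrite ltrBlDr ltrDl.
  have [|d /andP[d1 d2]] := between p.2 (p.2 + e); first by rewrite ltrDl.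
  exists (a, b, c, d) => //; rewrite /F; case: asboolP => [_|[]].
    by split=> /=; rewrite in_itv/= ?b1 ?d1 ltW.
  move=> q [] /=; rewrite !in_itv/= => /andP[q1 q2] /andP[q3 q4]; apply: he.
    by rewrite ltr_distlC; apply/andP; split; lra.
  by rewrite ltr_distlC; apply/andP; split; lra.
apply: countable_bigcupT_measurable; first exact: countableP.
move=> [[[a b] c] d]; rewrite /F; case: asboolP => // _; exact: measurable_box.
Qed.

(** This g dominates the kernel near its singularity. The sup norm stands in for the Euclidean one
    so that its balls are squares, whose areas are known. *)
Lemma integ_inv_norm : exists g, [/\ integ g, forall z, 0 <= g z &
  forall z : RR * RR, 0 < Num.max `|z.1| `|z.2| < 1 -> g z * Num.max `|z.1| `|z.2| = 1].
Proof.
pose m (z : RR * RR) : R := Num.max `|z.1| `|z.2|.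
(* Writing 1/m as exp(- ln m) gives measurability by composition; at the origin the convention ln 0
   = 0 makes this factor 1. *)
pose g z : R := \1_(box (-1) 1 (-1) 1) z * expR (- exp.ln (m z)).
have mm : measurable_fun setT m.
  by apply: measurable_maxr; apply: measurableT_comp.
have mg : measurable_fun setT g.
  apply: measurable_funM; first by apply: measurable_indic; exact: measurable_box.
  apply: measurableT_comp; first exact: measurable_expR.
  apply: measurableT_comp; first exact: oppr_measurable.
  by apply: measurableT_comp; first exact: measurable_ln.
have g0 z : 0 <= g z by rewrite mulr_ge0// expR_ge0.
exists g; split => //; last first.
  move=> z /andP[z0 z1]; rewrite /g indicE mem_set; last first.
    move: z1; rewrite gt_max => /andP[]; rewrite !ltr_norml => /andP[z3 z4] /andP[z5 z6].
    by split=> /=; rewrite in_itv/= ?z4 ?z6 ltW.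
  rewrite mul1r -/(m z) expRN lnK ?posrE// mulVf// gt_eqF//.
have pow0 n : (0 < 2 ^- n :> R) by rewrite invr_gt0 exprn_gt0.
(* Dyadic comparison: if 2^-(n+1) <= m z < 2^-n, then g z <= 2^(n+1), and the square of
   half-side 2^-n has area 4^(1-n), so the integrals of the u n form a geometric series. *)
pose u (n : nat) (z : RR * RR) : \bar R := (2 ^+ n.+1 * \1_(box (- 2 ^- n) (2 ^- n) (- 2 ^- n) (2 ^- n)) z)%:E.
have mu n : measurable_fun setT (u n).
  apply/measurable_EFinP; apply: measurable_funM => //.
  by apply: measurable_indic; exact: measurable_box.
have u0 n z : (0 <= u n z)%E by rewrite lee_fin mulr_ge0// exprn_ge0.
apply/integrableP; split; first exact/measurable_EFinP.
apply: (@le_lt_trans _ _ (\int[mu2]_z (\sum_(n <oo) u n z))%E).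
  apply: ge0_le_integral => //.
  - by apply: measurableT_comp => //; exact/measurable_EFinP.
  - exact: ge0_emeasurable_sum.
  move=> z _.
  have le_term n : g z <= 2 ^+ n.+1 -> box (- 2 ^- n) (2 ^- n) (- 2 ^- n) (2 ^- n) z ->
      (`|(EFin \o g) z| <= \sum_(n <oo) u n z)%E.
    move=> gz bz.
    apply: (@le_trans _ _ (\sum_(0 <= i < n.+1) u i z)%E); last first.
      by apply: nneseries_lim_ge => k _ _; exact: u0.
    rewrite big_nat_recr//= -[leLHS]add0e; apply: leeD; first exact: sume_ge0.
    by rewrite /u indicE mem_set// mulr1 lee_fin ger0_norm.
  have [zb|zb] := boolP (z \in box (-1) 1 (-1) 1); last first.
    rewrite /= /g indicE (negbTE zb) mul0r normr0.
    by apply: nneseries_ge0 => n _ _; exact: u0.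
  have gE : g z = expR (- exp.ln (m z)) by rewrite /g indicE zb mul1r.
  have m0 : 0 <= m z by rewrite le_max normr_ge0.
  have [m1|m1] := leP 1 (m z).
    apply: (le_term 0%N); last by rewrite expr0 invr1; move: zb; rewrite inE.
    rewrite gE (@le_trans _ _ 1)//; last by rewrite expr1; lra.
    by rewrite -exp.expR0 ler_expR oppr_le0 ln_ge0.
  move: m0; rewrite le_eqVlt => /predU1P[m0|m0].
    apply: (le_term 0%N); last by rewrite expr0 invr1; move: zb; rewrite inE.
    by rewrite gE -m0 ln0// oppr0 exp.expR0 expr1; lra.
  have gE' : g z = (m z)^-1 by rewrite gE expRN lnK.
  have ex : exists n, 2 ^- n.+1 <= m z.
    exists (Num.truncn (m z)^-1).
    rewrite invf_ple ?posrE ?exprn_gt0//.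
    apply: (le_trans (ltW (truncnS_gt _))).
    by rewrite -natrX ler_nat ltnW// ltn_expl.
  pose n := ex_minn ex.
  have [hn1 hn2] : 2 ^- n.+1 <= m z /\ m z < 2 ^- n.
    rewrite /n; case: ex_minnP => k hk hmin; split=> //.
    case: k hk hmin => [|k] hk hmin; first by rewrite expr0 invr1.
    by rewrite ltNge; apply/negP => /hmin; rewrite ltnn.
  apply: (le_term n).
    by rewrite gE' invf_ple ?posrE ?exprn_gt0.
  move: hn2; rewrite gt_max => /andP[]; rewrite !ltr_norml => /andP[z3 z4] /andP[z5 z6].
  by split=> /=; rewrite in_itv/= ?z4 ?z6 ltW.
rewrite integral_nneseries//.
(* The height 2^(n+1) times the area (2 * 2^-n)^2 is 8 / 2^n, written as 16 / 2^(n+1) to match the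
   geometric series of ratio 1/2. *)
have E n : (\int[mu2]_z u n z = (16 / (2 ^ (n + 1))%:R)%:E)%E.
  have p0 := pow0 n.
  have [i1 i2] := @integ_indic_box (- 2 ^- n) (2 ^- n) (- 2 ^- n) (2 ^- n)
    ltac:(lra) ltac:(lra).
  have [i3 i4] := I2Z (2 ^+ n.+1) i1.
  rewrite -[LHS]fineK; last exact: (integrable_fin_num measurableT i3).
  rewrite -[fine _]/(I2 _) i4 i2; congr EFin.
  rewrite addn1 natrX exprS.
  have : 2 ^+ n != 0 :> R by rewrite expf_neq0.
  by move=> h; field.
rewrite (eq_eseriesr (fun n _ => E n)).
have := @cvg_geometric_eseries_half R 16 0; move/cvg_lim => -> //.
exact: ltry.
Qed.
End PlaneSets.

(** * The measure theory restated for Stdlib reals *)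

Section StdlibInterface.
Local Open Scope classical_set_scope.
Local Open Scope ring_scope.

Definition RT : realType := Rdefinitions.R.
Notation R2 := (measurableTypeR RT * measurableTypeR RT)%type.

Definition meas (f : pt -> R) : Prop := measurable_fun (setT : set R2) (f : R2 -> RT).
Definition summable (f : pt -> R) : Prop := integ (f : R2 -> RT).
Definition int2 (f : pt -> R) : R := I2 (f : R2 -> RT).
Definition null (N : pt -> Prop) : Prop := (@mu2 RT).-negligible (N : set R2).
Definition scales (c : R) (T : pt -> pt) : Prop := @scales_area RT c T.

Local Open Scope R_scope.

Lemma summable_meas f : summable f -> meas f.
Proof. by move=> /integrableP[/measurable_EFinP]. Qed.

Lemma meas_cst c : meas (fun _ => c).
Proof. exact: measurable_cst. Qed.

Lemma meas_fst : meas fst.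
Proof. exact: measurable_fst. Qed.

Lemma meas_snd : meas snd.
Proof. exact: measurable_snd. Qed.

Lemma meas_plus f g : meas f -> meas g -> meas (fun p => f p + g p).
Proof. exact: measurable_funD. Qed.

Lemma meas_mult f g : meas f -> meas g -> meas (fun p => f p * g p).
Proof. exact: measurable_funM. Qed.

Lemma meas_opp f : meas f -> meas (fun p => - f p).
Proof.
move=> mf; apply: (measurableT_comp (f := fun x : RT => (- x)%R)) => //.
exact: oppr_measurable.
Qed.

Lemma meas_exp f : meas f -> meas (fun p => Rtrigo_def.exp (f p)).
Proof.
move=> mf; rewrite /meas (_ : (fun p => Rtrigo_def.exp (f p)) = @expR RT \o f).
  by apply: measurableT_comp => //; exact: measurable_expR.
by apply/funext => p /=; rewrite -RexpE.
Qed.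

Lemma meas_ln f : meas f -> meas (fun p => Rpower.ln (f p)).
Proof.
move=> mf; rewrite /meas (_ : (fun p => Rpower.ln (f p)) = @exp.ln RT \o f).
  by apply: measurableT_comp => //; exact: measurable_ln.
by apply/funext => p /=; rewrite -RlnE.
Qed.

Lemma meas_min f g : meas f -> meas g -> meas (fun p => Rmin (f p) (g p)).
Proof.
move=> mf mg; rewrite /meas (_ : (fun p => Rmin (f p) (g p)) = (f \min g : R2 -> RT)).
  exact: measurable_minr.
by apply/funext => p /=; rewrite RminE.
Qed.

Lemma meas_comp c T f : scales c T -> meas f -> meas (fun p => f (T p)).
Proof. by move=> [mT _ _] mf; exact: (measurableT_comp mf). Qed.

(** The same classical test as in [integral_over], so that the two integrands can be identified. *)
Definition charf (P : Prop) : R :=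
  match excluded_middle_informative P with left _ => 1 | right _ => 0 end.

Definition char_of (A : pt -> Prop) (p : pt) : R := charf (A p).

Lemma charfT (P : Prop) : P -> charf P = 1.
Proof. by rewrite /charf; case: excluded_middle_informative. Qed.

Lemma charfF (P : Prop) : ~ P -> charf P = 0.
Proof. by rewrite /charf; case: excluded_middle_informative. Qed.

Lemma meas_char_open U :
  (forall p, U p -> exists e, 0 < e /\
     forall q, Rabs (fst q - fst p) < e -> Rabs (snd q - snd p) < e -> U q) ->
  meas (char_of U).
Proof.
move=> oU; have mU : measurable (U : set R2).
  apply: box_open_measurable => p /oU[e [/RltP e0 he]].
  exists e => // q /RltP q1 /RltP q2; apply: he; by rewrite RabsE.
rewrite /meas (_ : char_of U = \1_(U : set R2)); first exact: measurable_indic.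
apply/funext => p; rewrite /char_of /charf indicE.
case: excluded_middle_informative => h; first by rewrite mem_set.
by rewrite memNset.
Qed.

Lemma int_plus f g : summable f -> summable g ->
  summable (fun p => f p + g p) /\ int2 (fun p => f p + g p) = int2 f + int2 g.
Proof. exact: I2D. Qed.

Lemma int_scal k f : summable f ->
  summable (fun p => k * f p) /\ int2 (fun p => k * f p) = k * int2 f.
Proof. exact: (@I2Z RT). Qed.

Lemma int_minus f g : summable f -> summable g ->
  summable (fun p => f p - g p) /\ int2 (fun p => f p - g p) = int2 f - int2 g.
Proof.
move=> hf hg; have [h1 h2] := int_scal (-1) hg.
have [h3 h4] := int_plus hf h1.
have E : (fun p => f p - g p) = (fun p => f p + -1 * g p).
  by apply/funext => p; Lra.lra.
by rewrite E h4 h2; split=> //; Lra.lra.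
Qed.

Lemma int_le f g : summable f -> summable g -> (forall p, f p <= g p) -> int2 f <= int2 g.
Proof. by move=> hf hg fg; apply/RleP/le_I2 => // p; apply/RleP. Qed.

Lemma summable_le f g : meas f -> summable g -> (forall p, Rabs (f p) <= g p) -> summable f.
Proof. by move=> mf hg fg; apply: (le_integ mf hg) => p; apply/RleP; rewrite -RabsE. Qed.

Lemma summable_abs f : summable f -> summable (fun p => Rabs (f p)).
Proof.
move=> hf; have := integrable_norm hf; rewrite /summable /integ.
by congr (_.-integrable _ _); apply/funext => p /=; rewrite RabsE.
Qed.

Lemma null_point p : null (fun q => q = p).
Proof. exact: negligible_point. Qed.

Lemma null_comp c T N : scales c T -> null N -> null (fun p => N (T p)).
Proof.
move=> [mT _ hT] [A [mA A0 NA]]; exists (T @^-1` A); split.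
- by rewrite -[X in measurable X]setTI; exact: mT.
- by have := hT A mA; rewrite A0 mule0.
- by move=> p; exact: NA.
Qed.

Lemma null_or A B : null A -> null B -> null (fun p => A p \/ B p).
Proof. exact: negligibleU. Qed.

Lemma null_sub A B : (forall p, A p -> B p) -> null B -> null A.
Proof. by move=> AB; apply: (@negligibleS _ R2 RT (@mu2 RT) B A). Qed.

Lemma int_eq0_null f : summable f -> (forall p, 0 <= f p) -> int2 f = 0 ->
  null (fun p => f p <> 0).
Proof.
move=> hf f0 h; apply: negligibleS (I2_eq0 hf _ h); last by move=> p; apply/RleP.
by move=> p /= /eqP.
Qed.

(** Subtracting min(f, 0) makes f nonnegative everywhere without changing its integral. This turns
    signs known almost everywhere into signs known everywhere. *)
Lemma int_neg_part f N : summable f -> null N -> (forall p, ~ N p -> 0 <= f p) ->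
  summable (fun p => Rmin (f p) 0) /\ int2 (fun p => Rmin (f p) 0) = 0.
Proof.
move=> hf nN f0; apply: null_I2; first exact: meas_min (summable_meas hf) (meas_cst 0).
apply: negligibleS nN => p /= /eqP h; apply: contrapT => /f0 h0; apply: h.
by rewrite Rmin_right.
Qed.

Lemma int_ge0_ae f N : summable f -> null N -> (forall p, ~ N p -> 0 <= f p) -> 0 <= int2 f.
Proof.
move=> hf nN f0; have [h1 h2] := int_neg_part hf nN f0.
rewrite -h2; apply: int_le => // p; exact: Rmin_l.
Qed.

(** All strict comparisons of potentials rest on this. If the integral were 0, then f - min(f, 0),
    nonnegative everywhere and of integral 0, would vanish off a null set; but a nondegenerate box
    is not null. *)
Lemma int_gt0_ae f N a b c d : summable f -> null N -> (forall p, ~ N p -> 0 <= f p) ->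
  a < b -> c < d -> (forall p, a <= fst p < b -> c <= snd p < d -> ~ N p -> 0 < f p) ->
  0 < int2 f.
Proof.
move=> hf nN f0 ab cd fp.
have := int_ge0_ae hf nN f0; case=> // /esym If0; exfalso.
have [h1 h2] := int_neg_part hf nN f0.
have [h3 h4] := int_minus hf h1.
have nP : null (fun p => f p - Rmin (f p) 0 <> 0).
  apply: (int_eq0_null h3) => [p|]; first by have := Rmin_l (f p) 0; Lra.lra.
  by rewrite h4 h2 -If0; Lra.lra.
have nM := null_or nP nN.
move/RltP: ab => ab; move/RltP: cd => cd.
have [p [/= + +] hp] := box_not_negligible ab cd nM.
rewrite !in_itv /= => /andP[/RleP p1 /RltP p2] /andP[/RleP p3 /RltP p4].
have fpp : 0 < f p by apply: fp; [split|split|move=> ?; apply: hp; right].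
apply: hp; left; rewrite Rmin_right; Lra.lra.
Qed.

Lemma int_change c T f : scales c T -> summable f ->
  summable (fun p => f (T p)) /\ int2 (fun p => f (T p)) = c * int2 f.
Proof.
move=> hT hf; split; [exact: scales_area_integ hT hf|exact: scales_area_I2 hT hf].
Qed.

Lemma int_dct (fn : nat -> pt -> R) f g N :
  (forall n, meas (fn n)) -> meas f -> null N ->
  (forall p, ~ N p -> forall eps, 0 < eps -> exists n0, forall n, (n0 <= n)%coq_nat ->
      Rabs (fn n p - f p) < eps) ->
  (forall n p, Rabs (fn n p) <= g p) -> summable g ->
  forall eps, 0 < eps -> exists n0, forall n, (n0 <= n)%coq_nat ->
    Rabs (int2 (fn n) - int2 f) < eps.
Proof.
move=> mfn mf nN cv fg ig eps /RltP e0.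
have := @I2_dct RT fn f g N mfn mf nN _ _ ig.
have h1 : (forall x : R2, ~ N x -> (fun n => fn n x : RT) @ \oo --> (f x : RT)).
  move=> x /cv h; apply/cvgrPdist_lt => e /RltP e1; have [n0 hn0] := h _ e1.
  exists n0 => // n /= /ssrnat.leP /hn0 /RltP; by rewrite RabsE distrC.
have h2 : (forall n (x : R2), (`|(fn n x : RT)| <= g x)%R).
  by move=> n x; apply/RleP; rewrite -RabsE.
move=> /(_ h1 h2) /cvgrPdist_lt /(_ _ e0) [n0 _ hn0].
exists n0 => n /ssrnat.leP /hn0 /= h; apply/RltP; by rewrite RabsE distrC.
Qed.

Lemma int_box a b c d : a <= b -> c <= d ->
  summable (char_of (fun p => a <= fst p < b /\ c <= snd p < d)) /\
  int2 (char_of (fun p => a <= fst p < b /\ c <= snd p < d)) = (b - a) * (d - c).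
Proof.
move=> /RleP ab /RleP cd.
have E : char_of (fun p => a <= fst p < b /\ c <= snd p < d) = \1_(@box RT a b c d) :> (R2 -> RT).
  apply/funext => p; rewrite /char_of /charf indicE.
  case: excluded_middle_informative => h.
    rewrite mem_set//; case: h => [[/RleP h1 /RltP h2] [/RleP h3 /RltP h4]].
    by split; rewrite /= in_itv/= ?h1 ?h3.
  rewrite memNset// => -[]; rewrite /= !in_itv/= => /andP[/RleP h1 /RltP h2] /andP[/RleP h3 /RltP h4].
  exact: h.
have [h1 h2] := integ_indic_box ab cd.
rewrite /summable /int2 E; split; [exact: h1|exact: h2].
Qed.

Lemma summable_inv_norm : exists g, summable g /\ (forall z, 0 <= g z) /\
  forall z, 0 < Rmax (Rabs (fst z)) (Rabs (snd z)) < 1 ->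
    g z * Rmax (Rabs (fst z)) (Rabs (snd z)) = 1.
Proof.
have [g [h1 h2 h3]] := @integ_inv_norm RT.
exists g; split=> //; split; first by move=> z; apply/RleP.
move=> z; rewrite RmaxE !RabsE => -[/RltP z1 /RltP z2]; apply: h3.
by rewrite z1 z2.
Qed.

Lemma scales_comp c d S T : scales c S -> scales d T -> scales (d * c) (fun p => S (T p)).
Proof. exact: (@scales_area_comp RT). Qed.

Lemma scales_swap : scales 1 (fun p => (snd p, fst p)).
Proof. exact: (@scales_area_swap RT). Qed.

Lemma scales_shear k (s a : R) : k <> 0 ->
  scales (/ Rabs k) (fun p => (fst p, s * fst p + a + k * snd p)).
Proof.
move=> /eqP k0; rewrite RabsE.
apply: (@scales_area_shear RT k (fun x => s * x + a) k0).
apply: measurable_funD => //; exact: measurable_funM.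
Qed.
End StdlibInterface.

From Stdlib Require Import Reals Rtrigo_def Rtrigo1 R_sqrt Rpower Lra Lia Ring Field.
Require Import Defs.
Unset SsrRewrite.
Unset Implicit Arguments.
Open Scope R_scope.

(** * Riemann sums *)

Lemma sumN_ext n f g : (forall i, (i < n)%coq_nat -> f i = g i) -> sumN n f = sumN n g.
Proof.
induction n as [|n IH]; intros H; simpl; [reflexivity|].
rewrite IH by (intros; apply H; lia). rewrite H by lia. reflexivity.
Qed.

Lemma sumN_minus n f g : sumN n f - sumN n g = sumN n (fun i => f i - g i).
Proof. induction n as [|n IH]; simpl; [ring|rewrite <- IH; ring]. Qed.

Lemma sumN_scal n k f : k * sumN n f = sumN n (fun i => k * f i).
Proof. induction n as [|n IH]; simpl; [ring|rewrite <- IH; ring]. Qed.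

Lemma sumN_Rabs_le n f g : (forall i, (i < n)%coq_nat -> Rabs (f i) <= g i) ->
  Rabs (sumN n f) <= sumN n g.
Proof.
induction n as [|n IH]; intros H; simpl; [rewrite Rabs_R0; lra|].
eapply Rle_trans; [apply Rabs_triang|].
apply Rplus_le_compat; [apply IH; intros; apply H; lia|apply H; lia].
Qed.

Lemma sumN_product n f g : sumN n f * sumN n g = sumN n (fun i => sumN n (fun j => f i * g j)).
Proof.
rewrite Rmult_comm, sumN_scal. apply sumN_ext. intros i _.
rewrite Rmult_comm, sumN_scal. reflexivity.
Qed.

(** Half-open although [in_cell] is closed: the cells then partition the half-open square, and each
    of its points selects exactly one tag. *)
Definition step (a h : R) (i : nat) (x : R) : R :=
  charf (a + INR i * h <= x < a + INR (S i) * h).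

Lemma sumN_step a h n x : 0 <= h ->
  sumN n (fun i => step a h i x) =
  charf (a <= x < a + INR n * h).
Proof.
intros Hh; induction n as [|n IH].
- cbn [sumN]. change (INR 0) with 0. rewrite charfF; lra.
- cbn [sumN]. rewrite IH. unfold step, charf.
  assert (H0 : 0 <= INR n * h) by (apply Rmult_le_pos; [apply pos_INR|lra]).
  rewrite S_INR.
  repeat destruct (excluded_middle_informative _); try (exfalso; lra); try lra.
Qed.

Lemma int_sumN n (f : nat -> pt -> R) : (forall i, (i < n)%coq_nat -> summable (f i)) ->
  summable (fun p => sumN n (fun i => f i p)) /\
  int2 (fun p => sumN n (fun i => f i p)) = sumN n (fun i => int2 (f i)).
Proof.
induction n as [|n IH]; intros H; simpl.
- destruct (@int_box 0 0 0 0) as [h1 h2]; try lra.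
  destruct (int_scal 0 h1) as [h3 h4]. rewrite h2 in h4.
  assert (E : (fun _ => 0 : R) = (fun p => 0 * char_of (fun q => 0 <= fst q < 0 /\ 0 <= snd q < 0) p)).
  { apply funext; intros p; ring. }
  rewrite E, h4. split; [exact h3|ring].
- destruct IH as [h1 h2]; [intros; apply H; lia|].
  rewrite <- h2. exact (int_plus h1 (H n ltac:(lia))).
Qed.

(** Lebesgue's criterion by dominated convergence: a Riemann sum is the integral of the step
    function whose value on a cell is f at the tag, and as the mesh shrinks these step functions
    converge to f wherever f is continuous. *)
Lemma riemann_integral f R0 C N : 0 < R0 -> summable f -> null N ->
  (forall p, Rabs (f p) <= C) ->
  (forall p, f p <> 0 -> Rabs (fst p) < R0 /\ Rabs (snd p) < R0) ->
  (forall p, ~ N p -> forall eps, 0 < eps -> exists d, 0 < d /\ forall q,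
     Rabs (fst q - fst p) < d -> Rabs (snd q - snd p) < d -> Rabs (f q - f p) < eps) ->
  square_integral f R0 (int2 f).
Proof.
intros HR Hf HN HC Hsupp Hcont eps Heps.
apply NNPP; intros Hno.
assert (Hbad : forall m : nat, exists nt : nat * (nat -> nat -> pt),
  (m <= fst nt)%coq_nat /\ (0 < fst nt)%coq_nat /\
  (forall i j, (i < fst nt)%coq_nat -> (j < fst nt)%coq_nat -> in_cell R0 (fst nt) i j (snd nt i j)) /\
  ~ Rabs (sumN (fst nt) (fun i => sumN (fst nt) (fun j => f (snd nt i j)))
        * ((2 * R0 / INR (fst nt)) * (2 * R0 / INR (fst nt))) - int2 f) < eps).
{ intros m. apply NNPP; intros Hm. apply Hno. exists m. intros n Hn1 Hn2 tag Htag.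
  apply NNPP; intros Hn3. apply Hm. exists (n, tag). simpl; auto. }
(* If the claim fails, choice yields for every m a tagged grid with at least m cells per side and an
   error of at least eps. This gives the sequence to which dominated convergence applies. *)
pose (nt m := proj1_sig (ClassicalEpsilon.constructive_indefinite_description _ (Hbad m))).
assert (Hnt := fun m => proj2_sig (ClassicalEpsilon.constructive_indefinite_description _ (Hbad m))).
change (forall m, (m <= fst (nt m))%coq_nat /\ (0 < fst (nt m))%coq_nat /\
  (forall i j, (i < fst (nt m))%coq_nat -> (j < fst (nt m))%coq_nat ->
     in_cell R0 (fst (nt m)) i j (snd (nt m) i j)) /\
  ~ Rabs (sumN (fst (nt m)) (fun i => sumN (fst (nt m)) (fun j => f (snd (nt m) i j)))
        * ((2 * R0 / INR (fst (nt m))) * (2 * R0 / INR (fst (nt m)))) - int2 f) < eps) in Hnt.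
clearbody nt.
pose (h m := 2 * R0 / INR (fst (nt m))).
assert (Hn : forall m, 0 < INR (fst (nt m))).
{ intros m. apply lt_0_INR. apply Hnt. }
assert (Hh : forall m, 0 < h m).
{ intros m. unfold h. apply Rdiv_lt_0_compat; [lra|apply Hn]. }
pose (chi m i j (p : pt) := step (- R0) (h m) i (fst p) * step (- R0) (h m) j (snd p)).
pose (F m p := sumN (fst (nt m)) (fun i => sumN (fst (nt m)) (fun j =>
   f (snd (nt m) i j) * chi m i j p))).
assert (Hchi : forall m i j, summable (chi m i j) /\ int2 (chi m i j) = h m * h m).
{ intros m i j.
  assert (E : chi m i j = char_of (fun p => - R0 + INR i * h m <= fst p < - R0 + INR (S i) * h m /\
     - R0 + INR j * h m <= snd p < - R0 + INR (S j) * h m)).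
  { apply funext; intros p. unfold chi, step, char_of, charf.
    repeat destruct (excluded_middle_informative _); try lra; exfalso; tauto. }
  rewrite E. specialize (Hh m).
  destruct (@int_box (- R0 + INR i * h m) (- R0 + INR (S i) * h m)
     (- R0 + INR j * h m) (- R0 + INR (S j) * h m)) as [h1 h2].
  - rewrite S_INR; lra.
  - rewrite S_INR; lra.
  - split; [exact h1|rewrite h2, !S_INR; ring]. }
pose (sq := char_of (fun p => - R0 <= fst p < R0 /\ - R0 <= snd p < R0)).
assert (Hsum : forall m p, sumN (fst (nt m)) (fun i => sumN (fst (nt m)) (fun j => chi m i j p)) = sq p).
{ intros m p. unfold chi. rewrite <- sumN_product, !sumN_step by (left; apply Hh).
  assert (E : - R0 + INR (fst (nt m)) * h m = R0).
  { unfold h. field. specialize (Hn m); lra. }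
  rewrite E. unfold sq, char_of, charf.
  repeat destruct (excluded_middle_informative _); try lra; exfalso; tauto. }
assert (HchiP : forall m i j p, chi m i j p = 0 \/ (chi m i j p = 1 /\
   - R0 + INR i * h m <= fst p < - R0 + INR (S i) * h m /\
   - R0 + INR j * h m <= snd p < - R0 + INR (S j) * h m)).
{ intros m i j p. unfold chi, step, charf.
  repeat destruct (excluded_middle_informative _); [right|left|left|left]; split || idtac; try lra; tauto. }
assert (HF : forall m, summable (F m) /\ int2 (F m) =
  sumN (fst (nt m)) (fun i => sumN (fst (nt m)) (fun j => f (snd (nt m) i j))) * (h m * h m)).
{ intros m.
  destruct (int_sumN (fst (nt m)) (fun i p => sumN (fst (nt m)) (fun j =>
    f (snd (nt m) i j) * chi m i j p))) as [h1 h2].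
  - intros i _. apply int_sumN. intros j _. apply int_scal. apply Hchi.
  - split; [exact h1|]. unfold F. rewrite h2. rewrite Rmult_comm, sumN_scal.
    apply sumN_ext. intros i _.
    rewrite (proj2 (int_sumN (fst (nt m)) (fun j p => f (snd (nt m) i j) * chi m i j p)
      ltac:(intros j _; apply int_scal; apply Hchi))).
    rewrite sumN_scal. apply sumN_ext. intros j _.
    rewrite (proj2 (int_scal _ (proj1 (Hchi m i j)))), (proj2 (Hchi m i j)). ring. }
assert (HFC : forall m p, Rabs (F m p) <= C * sq p).
{ intros m p. unfold F. rewrite <- (Hsum m p), sumN_scal.
  apply sumN_Rabs_le. intros i _. rewrite sumN_scal. apply sumN_Rabs_le. intros j _.
  rewrite Rabs_mult. specialize (HC (snd (nt m) i j)).
  destruct (HchiP m i j p) as [e|[e _]]; rewrite e.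
  - rewrite Rabs_R0; lra.
  - rewrite Rabs_R1; lra. }
destruct (@int_box (- R0) R0 (- R0) R0) as [hsq _]; try lra. fold sq in hsq.
destruct (int_dct (fn := F) (f := f) (g := fun p => C * sq p) (N := N)) with (eps := eps) as [m0 Hm0].
- intros m. apply summable_meas, HF.
- apply summable_meas, Hf.
- exact HN.
- intros p Np e He.
  destruct (excluded_middle_informative (- R0 <= fst p < R0 /\ - R0 <= snd p < R0)) as [Hp|Hp].
  2:{ exists 0%nat. intros m _.
      assert (e1 : sq p = 0) by (unfold sq, char_of, charf; destruct (excluded_middle_informative _); tauto).
      assert (e2 : f p = 0).
      { apply NNPP; intros Hfp. apply Hsupp in Hfp. apply Hp.
        destruct Hfp as [q1 q2]. apply Rabs_def2 in q1; apply Rabs_def2 in q2. lra. }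
      pose proof (HFC m p) as H. rewrite e1 in H. rewrite e2, Rminus_0_r. lra. }
  destruct (Hcont p Np (e/2) ltac:(lra)) as [d [Hd Hdp]].
  destruct (INR_unbounded (2 * R0 / d)) as [m0 Hm0].
  exists m0. intros m Hm.
  assert (Hhd : h m < d).
  { unfold h. apply Rmult_lt_reg_r with (INR (fst (nt m))); [apply Hn|].
    replace (2 * R0 / INR (fst (nt m)) * INR (fst (nt m))) with (2 * R0) by (field; specialize (Hn m); lra).
    assert (INR m0 <= INR (fst (nt m))).
    { apply le_INR. destruct (Hnt m). lia. }
    replace (2 * R0) with (d * (2 * R0 / d)) by (field; lra).
    apply Rmult_lt_compat_l; lra. }
  assert (e1 : sq p = 1) by (unfold sq, char_of, charf; destruct (excluded_middle_informative _); tauto).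
  apply Rle_lt_trans with (e / 2 * sq p); [|rewrite e1; lra].
  replace (f p) with (f p * sq p) by (rewrite e1; ring).
  rewrite <- (Hsum m p) at 1. unfold F. rewrite sumN_scal, sumN_minus.
  rewrite <- (Hsum m p), sumN_scal. apply sumN_Rabs_le. intros i Hi.
  rewrite !sumN_scal, sumN_minus. apply sumN_Rabs_le. intros j Hj.
  rewrite <- Rmult_minus_distr_r, Rabs_mult.
  (* Only the cell containing p contributes, and its tag is within one mesh width, less than d, of p
     in each coordinate. *)
  destruct (HchiP m i j p) as [e2|[e2 [p1 p2]]]; rewrite e2.
  + rewrite Rabs_R0; lra.
  + rewrite Rabs_R1. destruct (proj1 (proj2 (proj2 (Hnt m))) i j Hi Hj) as [t1 t2].
    fold (h m) in t1, t2.
    rewrite S_INR in p1, p2, t1, t2.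
    rewrite !Rmult_1_r. left. apply Hdp; apply Rabs_def1; lra.
- exact HFC.
- apply int_scal; exact hsq.
- exact Heps.
- specialize (Hm0 m0 (le_n _)). rewrite (proj2 (HF m0)) in Hm0.
  apply (proj2 (proj2 (proj2 (Hnt m0)))). exact Hm0.
Qed.

(** * The kernel *)

Lemma scales_eq c T T' : (forall p, T p = T' p) -> scales c T -> scales c T'.
Proof. intros H; replace T' with T; [auto|apply funext; exact H]. Qed.

Lemma scales_diag a b k l : k <> 0 -> l <> 0 ->
  scales (/ Rabs k * / Rabs l) (fun p => (a + k * fst p, b + l * snd p)).
Proof.
intros Hk Hl.
pose proof (scales_comp scales_swap (scales_comp (scales_shear 0 a Hk) scales_swap)) as H1.
pose proof (scales_comp H1 (scales_shear 0 b Hl)) as H2.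
replace (/ Rabs k * / Rabs l) with (/ Rabs l * (1 * / Rabs k * 1)) by ring.
refine (scales_eq _ _ _ _ H2). intros p; simpl. f_equal; ring.
Qed.

Definition padd (p q : pt) : pt := (fst p + fst q, snd p + snd q).
Definition nrm (p : pt) : R := sqrt (fst p ^ 2 + snd p ^ 2).

Lemma sqrt_sum_ge_l x y : Rabs x <= sqrt (x ^ 2 + y ^ 2).
Proof.
rewrite <- sqrt_Rsqr_abs. apply sqrt_le_1_alt. unfold Rsqr. pose proof (pow2_ge_0 y). lra.
Qed.

Lemma sqrt_sum_ge_r x y : Rabs y <= sqrt (x ^ 2 + y ^ 2).
Proof. rewrite Rplus_comm. apply sqrt_sum_ge_l. Qed.

Lemma sqrt_sum_le x y : sqrt (x ^ 2 + y ^ 2) <= Rabs x + Rabs y.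
Proof.
pose proof (Rabs_pos x); pose proof (Rabs_pos y).
rewrite <- (sqrt_Rsqr (Rabs x + Rabs y)) by lra.
apply sqrt_le_1_alt. unfold Rsqr.
rewrite <- (pow2_abs x), <- (pow2_abs y). nra.
Qed.

Lemma dist2_lt_box p q e : Rabs (fst q - fst p) < e / 2 -> Rabs (snd q - snd p) < e / 2 ->
  dist2 p q < e.
Proof.
intros H1 H2. unfold dist2. eapply Rle_lt_trans; [apply sqrt_sum_le|].
rewrite (Rabs_minus_sym (fst p)), (Rabs_minus_sym (snd p)). lra.
Qed.

Definition kern (alpha r : R) : R :=
  match Req_dec_T alpha 2 with left _ => - ln r | right _ => Rpower r (alpha - 2) end.

Lemma kernelE alpha x y : kernel alpha x y = kern alpha (dist2 y x).
Proof. reflexivity. Qed.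

Lemma ln_0 : ln 0 = 0.
Proof. unfold ln. destruct (Rlt_dec 0 0) as [h|h]; [exfalso; lra|reflexivity]. Qed.

Lemma ln_sqrt s : 0 <= s -> ln (sqrt s) = / 2 * ln s.
Proof.
intros [H|<-]; [|rewrite sqrt_0, ln_0; ring].
rewrite <- (sqrt_sqrt s) at 2 by lra.
rewrite ln_mult by (apply sqrt_lt_R0; lra). field.
Qed.

Lemma ln_le_sub1 x : 0 < x -> ln x <= x - 1.
Proof.
intros H. pose proof (exp_ineq1_le (ln x)). rewrite exp_ln in H0 by lra. lra.
Qed.

Lemma ln_abs_bound r : 0 < r -> - / r <= ln r <= r.
Proof.
intros H. pose proof (ln_le_sub1 r H).
pose proof (ln_le_sub1 (/ r) (Rinv_0_lt_compat _ H)). rewrite ln_Rinv in H1 by lra. lra.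
Qed.

(** Since |alpha - 2| < 1, the power is at most r for r >= 1 and at most 1/r for r < 1; the
    logarithm is handled by ln x <= x - 1 at r and at 1/r. The first bound gives integrability, the
    second bounds the truncations from below. *)
Lemma kern_bound alpha r : 1 < alpha < 3 -> 0 < r -> Rabs (kern alpha r) <= / r + r /\ - r <= kern alpha r.
Proof.
intros Ha Hr. pose proof (Rinv_0_lt_compat _ Hr) as Hi.
unfold kern. destruct (Req_dec_T alpha 2) as [e|ne].
- pose proof (ln_abs_bound r Hr). split; [|lra]. apply Rabs_le. lra.
- assert (Hp : 0 < Rpower r (alpha - 2)) by apply exp_pos.
  split; [|lra]. rewrite Rabs_right by lra.
  destruct (Rle_lt_dec 1 r) as [H|H].
  + assert (Rpower r (alpha - 2) <= Rpower r 1) by (apply Rle_Rpower; lra).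
    rewrite Rpower_1 in H0 by lra. lra.
  + assert (Rpower (/ r) (2 - alpha) <= Rpower (/ r) 1).
    { apply Rle_Rpower; [|lra]. rewrite <- Rinv_1. apply Rinv_le_contravar; lra. }
    rewrite Rpower_1 in H0 by lra.
    replace (Rpower r (alpha - 2)) with (Rpower (/ r) (2 - alpha)); [lra|].
    unfold Rpower. f_equal. rewrite ln_Rinv by lra. ring.
Qed.

(* Stdlib sets ln 0 = 0, so the kernel takes a finite junk value at its singularity. *)
Lemma kern_0 alpha : 0 <= kern alpha 0 <= 1.
Proof.
unfold kern, Rpower. rewrite ln_0. destruct (Req_dec_T alpha 2); [lra|].
rewrite Rmult_0_r, exp_0. lra.
Qed.

(** Only differences scale uniformly in alpha: for the logarithm the constant ln c cancels and the
    factor is c^0 = 1. *)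
Lemma kern_scaling alpha c r s : 0 < c -> 0 < r -> 0 < s ->
  kern alpha (c * r) - kern alpha (c * s) =
  Rpower c (alpha - 2) * (kern alpha r - kern alpha s).
Proof.
intros Hc Hr Hs. unfold kern. destruct (Req_dec_T alpha 2) as [e|ne].
- rewrite !ln_mult by lra. rewrite e, Rminus_diag, Rpower_O by lra. ring.
- rewrite <- !Rpower_mult_distr by lra. ring.
Qed.

(* With this sign the kernel decreases in r, so that centers are maxima for every alpha. *)
Definition ksign (alpha : R) : R :=
  match Rle_dec alpha 2 with left _ => 1 | right _ => -1 end.

Lemma kern_decr alpha r s : 0 < r < s -> ksign alpha * kern alpha s < ksign alpha * kern alpha r.
Proof.
intros H. pose proof (ln_increasing r s) as Hl. unfold ksign, kern, Rpower.
destruct (Rle_dec alpha 2), (Req_dec_T alpha 2); try (exfalso; lra); simpl.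
- lra.
- enough (exp ((alpha - 2) * ln s) < exp ((alpha - 2) * ln r)) by lra.
  apply exp_increasing. nra.
- enough (exp ((alpha - 2) * ln r) < exp ((alpha - 2) * ln s)) by lra.
  apply exp_increasing. nra.
Qed.

Lemma kern_continuity alpha r : 0 < r -> continuity_pt (kern alpha) r.
Proof.
intros Hr. unfold kern. destruct (Req_dec_T alpha 2) as [e|ne].
- apply continuity_pt_opp. apply derivable_continuous_pt. exists (/ r). apply derivable_pt_lim_ln; lra.
- apply derivable_continuous_pt. exists ((alpha - 2) * Rpower r (alpha - 2 - 1)).
  apply derivable_pt_lim_power; lra.
Qed.

(** Both kernels are functions of the logarithm of the norm, which is half the logarithm of a
    polynomial. [ln_sqrt] covers the origin as well, so the rewriting holds at every point. *)
Lemma meas_kern_nrm alpha : meas (fun z => kern alpha (nrm z)).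
Proof.
assert (H : meas (fun z => / 2 * ln (fst z * fst z + snd z * snd z))).
{ apply meas_mult; [apply meas_cst|]. apply meas_ln.
  apply meas_plus; apply meas_mult; first [apply meas_fst|apply meas_snd]. }
assert (E : forall z, ln (nrm z) = / 2 * ln (fst z * fst z + snd z * snd z)).
{ intros z. unfold nrm. replace (fst z ^ 2 + snd z ^ 2) with (fst z * fst z + snd z * snd z) by ring.
  apply ln_sqrt. nra. }
unfold kern. destruct (Req_dec_T alpha 2) as [e|ne].
- replace (fun z => - ln (nrm z)) with (fun z => - (/ 2 * ln (fst z * fst z + snd z * snd z))).
  + apply meas_opp; exact H.
  + apply funext; intros z. rewrite E; reflexivity.
- unfold Rpower.
  replace (fun z => exp ((alpha - 2) * ln (nrm z))) with
    (fun z => exp ((alpha - 2) * (/ 2 * ln (fst z * fst z + snd z * snd z)))).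
  + apply meas_exp. apply meas_mult; [apply meas_cst|exact H].
  + apply funext; intros z. rewrite E; reflexivity.
Qed.

(** * Distances, convex bodies and their boundary *)

Lemma dist2_sym p q : dist2 p q = dist2 q p.
Proof. unfold dist2. f_equal. ring. Qed.

Lemma dist2_tri p q r : dist2 p r <= dist2 p q + dist2 q r.
Proof.
pose proof (triangle (fst p) (snd p) (fst r) (snd r) (fst q) (snd q)) as H.
unfold dist_euc, Rsqr in H. unfold dist2. simpl. rewrite !Rmult_1_r. exact H.
Qed.

Lemma dist2_pos p q : 0 <= dist2 p q.
Proof. apply sqrt_pos. Qed.

Lemma dist2_eq0 p q : dist2 p q = 0 -> p = q.
Proof.
intros H. pose proof (sqrt_sum_ge_l (fst p - fst q) (snd p - snd q)) as H1.
pose proof (sqrt_sum_ge_r (fst p - fst q) (snd p - snd q)) as H2.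
fold (dist2 p q) in H1, H2. rewrite H in H1, H2.
destruct p as [p1 p2], q as [q1 q2]; simpl in *.
pose proof (Rle_abs (p1 - q1)). pose proof (Rle_abs (- (p1 - q1))). rewrite Rabs_Ropp in H3.
pose proof (Rle_abs (p2 - q2)). pose proof (Rle_abs (- (p2 - q2))). rewrite Rabs_Ropp in H5.
f_equal; lra.
Qed.

Lemma dist2_ge_fst p q : Rabs (fst p - fst q) <= dist2 p q.
Proof. apply sqrt_sum_ge_l. Qed.

Lemma dist2_ge_snd p q : Rabs (snd p - snd q) <= dist2 p q.
Proof. apply sqrt_sum_ge_r. Qed.

Lemma dist2_le p q : dist2 p q <= Rabs (fst p - fst q) + Rabs (snd p - snd q).
Proof. apply sqrt_sum_le. Qed.

Lemma dist2_homothety k p q p' q' : fst p' - fst q' = k * (fst p - fst q) ->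
  snd p' - snd q' = k * (snd p - snd q) -> dist2 p' q' = Rabs k * dist2 p q.
Proof.
intros H1 H2. unfold dist2. rewrite H1, H2.
rewrite <- (sqrt_Rsqr_abs k), <- sqrt_mult_alt by apply Rle_0_sqr.
f_equal. unfold Rsqr. ring.
Qed.

(** The homothety with center z and ratio 1 - t carries a ball about p0 inside O to a ball about the
    combination; [p'] is the preimage of q under it. *)
Lemma interior_combination O z p0 t : convex_set O -> interior_pt O p0 -> O z -> 0 <= t < 1 ->
  interior_pt O (t * fst z + (1 - t) * fst p0, t * snd z + (1 - t) * snd p0).
Proof.
intros HC [e [He Hb]] Hz Ht. exists ((1 - t) * e). split; [apply Rmult_lt_0_compat; lra|].
intros q Hq.
pose (p' := ((fst q - t * fst z) / (1 - t), (snd q - t * snd z) / (1 - t))).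
assert (Hp' : O p').
{ apply Hb. apply Rmult_lt_reg_l with (1 - t); [lra|].
  eapply Rle_lt_trans; [|exact Hq]. right.
  rewrite (dist2_homothety (1 - t) p0 p' (t * fst z + (1 - t) * fst p0, t * snd z + (1 - t) * snd p0) q).
  - rewrite Rabs_right by lra. reflexivity.
  - unfold p'; simpl; field; lra.
  - unfold p'; simpl; field; lra. }
pose proof (HC z p' t Hz Hp' ltac:(lra)) as H. unfold p' in H; simpl in H.
replace q with (t * fst z + (1 - t) * ((fst q - t * fst z) / (1 - t)),
   t * snd z + (1 - t) * ((snd q - t * snd z) / (1 - t))); [exact H|].
destruct q as [q1 q2]; simpl. f_equal; field; lra.
Qed.

Lemma closed_meas O : closed_set O -> meas (char_of O).
Proof.
intros HO.
assert (H : meas (char_of (fun p => ~ O p))).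
{ apply meas_char_open. intros p Hp. destruct (HO p Hp) as [e [He Hq]].
  exists (e / 2). split; [lra|]. intros q H1 H2. apply Hq. apply dist2_lt_box; assumption. }
replace (char_of O) with (fun p => 1 + -1 * char_of (fun p => ~ O p) p).
- apply meas_plus; [apply meas_cst|]. apply meas_mult; [apply meas_cst|exact H].
- apply funext; intros p. unfold char_of, charf.
  repeat destruct (excluded_middle_informative _); try lra; exfalso; tauto.
Qed.

Lemma interior_meas O : meas (char_of (interior_pt O)).
Proof.
apply meas_char_open. intros p [e [He Hb]]. exists (e / 4). split; [lra|].
intros q H1 H2. exists (e / 4). split; [lra|]. intros r Hr. apply Hb.
pose proof (dist2_ge_fst q r). pose proof (dist2_ge_snd q r).
rewrite Rabs_minus_sym in H, H0.
apply dist2_lt_box.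
- replace (fst r - fst p) with ((fst r - fst q) + (fst q - fst p)) by ring.
  eapply Rle_lt_trans; [apply Rabs_triang|]; lra.
- replace (snd r - snd p) with ((snd r - snd q) + (snd q - snd p)) by ring.
  eapply Rle_lt_trans; [apply Rabs_triang|]; lra.
Qed.

Lemma bounded_in_box O : bounded_set O -> exists B, 0 < B /\
  forall p, O p -> Rabs (fst p) < B /\ Rabs (snd p) < B.
Proof.
intros [M HM]. exists (Rabs M + 1). pose proof (Rabs_pos M). split; [lra|].
intros p Hp. pose proof (HM p Hp). pose proof (Rle_abs M).
pose proof (dist2_ge_fst p (0,0)). pose proof (dist2_ge_snd p (0,0)). simpl in *.
rewrite Rminus_0_r in H2, H3. lra.
Qed.

Lemma charf_01 P : 0 <= charf P <= 1.
Proof. unfold charf. destruct (excluded_middle_informative P); lra. Qed.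

Lemma charf_le (P Q : Prop) : (P -> Q) -> charf P <= charf Q.
Proof.
intros H. unfold charf. repeat destruct (excluded_middle_informative _); try lra; exfalso; tauto.
Qed.

Lemma char_of_summable A B : meas (char_of A) ->
  (forall p, A p -> Rabs (fst p) < B /\ Rabs (snd p) < B) -> 0 <= B -> summable (char_of A).
Proof.
intros mA HA HB. destruct (@int_box (- B) B (- B) B) as [h _]; try lra.
apply (summable_le mA h). intros p. rewrite Rabs_right by (apply Rle_ge, charf_01).
apply charf_le. intros Hp. destruct (HA p Hp) as [h1 h2].
apply Rabs_def2 in h1; apply Rabs_def2 in h2. lra.
Qed.

(* O is contained in every dilation of ratio > 1 of its interior about an interior point. *)
Lemma boundary_null O : convex_body O -> null (boundary_pt O).
Proof.
intros [HC [Hcl [Hbd [p0 Hp0]]]].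
destruct (bounded_in_box O Hbd) as [B [HB HOB]].
assert (Hint : forall p, interior_pt O p -> O p).
{ intros p [e [He Hp]]. apply Hp. unfold dist2. rewrite !Rminus_diag.
  replace (0 ^ 2 + 0 ^ 2) with 0 by ring. rewrite sqrt_0. exact He. }
assert (s1 : summable (char_of O)) by (apply (char_of_summable O B); auto using closed_meas; lra).
assert (s2 : summable (char_of (interior_pt O))).
{ apply (char_of_summable _ B); auto using interior_meas; lra. }
assert (Hle : int2 (char_of O) <= int2 (char_of (interior_pt O))).
{ assert (Hl : forall t, 0 < t < 1 -> t * t * int2 (char_of O) <= int2 (char_of (interior_pt O))).
  { intros t Ht.
    assert (Hs := scales_diag ((1 - t) * fst p0) ((1 - t) * snd p0) t t ltac:(lra) ltac:(lra)).
    destruct (int_change Hs s2) as [h1 h2].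
    rewrite Rabs_right in h2 by lra.
    assert (int2 (char_of O) <= / t * / t * int2 (char_of (interior_pt O))).
    { rewrite <- h2. apply (int_le s1 h1). intros p. apply charf_le. intros Hp.
      pose proof (interior_combination O p p0 t HC Hp0 Hp ltac:(lra)) as H.
      rewrite (Rplus_comm (t * fst p)), (Rplus_comm (t * snd p)) in H. exact H. }
    apply Rmult_le_compat_l with (r := t * t) in H; [|nra].
    replace (t * t * (/ t * / t * int2 (char_of (interior_pt O)))) with
      (int2 (char_of (interior_pt O))) in H by (field; lra).
    exact H. }
  assert (0 <= int2 (char_of O)).
  { apply (int_ge0_ae s1 (null_point (0,0))). intros p _. apply charf_01. }
  apply Rnot_lt_le; intros Hlt.
  set (a := int2 (char_of O)) in *. set (b := int2 (char_of (interior_pt O))) in *.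
  (* One value of t replaces the limit t -> 1: for d = (a - b) / (4a) and t = 1 - d, t^2 a >= a -
     2da = (a + b)/2 > b. The value t = 1/2 serves to show b >= 0, hence a > 0 and d < 1. *)
  pose proof (Hl (1/2) ltac:(lra)) as Hhalf.
  assert (Hd : 0 < (a - b) / (4 * a) < 1).
  { split; [apply Rdiv_lt_0_compat; lra|]. apply Rmult_lt_reg_r with (4 * a); [lra|].
    unfold Rdiv. rewrite Rmult_assoc, Rinv_l by lra.
    lra. }
  pose proof (Hl (1 - (a - b) / (4 * a)) ltac:(lra)) as H1.
  set (d := (a - b) / (4 * a)) in *.
  assert (d * (4 * a) = a - b) by (unfold d; field; lra).
  nra. }
destruct (int_minus s1 s2) as [s3 e3].
assert (Hge : forall p, 0 <= char_of O p - char_of (interior_pt O) p).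
{ intros p. pose proof (charf_le _ _ (Hint p)). unfold char_of. lra. }
assert (Hz : int2 (fun p => char_of O p - char_of (interior_pt O) p) = 0).
{ pose proof (int_ge0_ae s3 (null_point (0,0)) (fun p _ => Hge p)). lra. }
eapply null_sub; [|exact (int_eq0_null s3 Hge Hz)].
intros p [h1 h2]. unfold char_of. rewrite charfT by assumption. rewrite charfF by assumption. lra.
Qed.

(** * The potential *)

Definition pot (O : pt -> Prop) (alpha : R) (x : pt) : R :=
  int2 (fun z => charf (O z) * kern alpha (dist2 z x)).

(** Translating by x keeps the singularity at the origin and moves the set instead. A single G then
    serves all x in a square, as continuity in x demands. *)
Lemma potential_dominator O alpha X : 1 < alpha < 3 -> bounded_set O -> 0 <= X ->
  exists G, summable G /\ forall x z, Rabs (fst x) <= X -> Rabs (snd x) <= X ->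
    Rabs (charf (O (padd z x)) * kern alpha (nrm z)) <= G z.
Proof.
intros Ha Hb HX. destruct (bounded_in_box O Hb) as [B0 [HB0 HO]].
destruct summable_inv_norm as [g [sg [g0 gP]]].
pose (B := B0 + X).
destruct (@int_box (- B) B (- B) B) as [hb _]; try (unfold B; lra).
set (bx := char_of _) in hb.
(* On the box, 2B bounds the norm; 1 bounds both 1/r outside the unit square, where [g] gives no
   information, and the value of the kernel at 0. *)
destruct (int_scal (1 + 2 * B) hb) as [hb2 _].
destruct (int_plus sg hb2) as [hG _].
eexists; split; [exact hG|]. intros x z H1 H2. simpl.
pose proof (g0 z) as Hg. pose proof (charf_01 (- B <= fst z < B /\ - B <= snd z < B)) as Hbx.
destruct (excluded_middle_informative (O (padd z x))) as [Hz|Hz].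
2:{ rewrite charfF by exact Hz. rewrite Rmult_0_l, Rabs_R0.
    apply Rplus_le_le_0_compat; [exact Hg|]. apply Rmult_le_pos; [unfold B; lra|apply Hbx]. }
rewrite charfT by exact Hz. rewrite Rmult_1_l.
destruct (HO _ Hz) as [K1 K2]. simpl in K1, K2.
assert (Z1 : Rabs (fst z) < B).
{ replace (fst z) with ((fst z + fst x) + - fst x) by ring.
  eapply Rle_lt_trans; [apply Rabs_triang|]. rewrite Rabs_Ropp. unfold B; lra. }
assert (Z2 : Rabs (snd z) < B).
{ replace (snd z) with ((snd z + snd x) + - snd x) by ring.
  eapply Rle_lt_trans; [apply Rabs_triang|]. rewrite Rabs_Ropp. unfold B; lra. }
assert (e : bx z = 1).
{ unfold bx, char_of. apply charfT. apply Rabs_def2 in Z1; apply Rabs_def2 in Z2. lra. }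
rewrite e, Rmult_1_r.
assert (N1 : Rabs (fst z) <= nrm z) by apply sqrt_sum_ge_l.
assert (N2 : Rabs (snd z) <= nrm z) by apply sqrt_sum_ge_r.
assert (N3 : nrm z <= 2 * B) by (eapply Rle_trans; [apply sqrt_sum_le|lra]).
destruct (Req_dec (nrm z) 0) as [e0|ne].
{ rewrite e0. pose proof (kern_0 alpha). rewrite Rabs_right by lra. unfold B in *; lra. }
assert (N4 : 0 < nrm z) by (pose proof (sqrt_pos (fst z ^ 2 + snd z ^ 2)); fold (nrm z) in *; lra).
destruct (kern_bound alpha (nrm z) Ha N4) as [K _].
set (m := Rmax (Rabs (fst z)) (Rabs (snd z))) in *.
assert (Hm : 0 < m).
{ apply Rnot_le_lt; intros Hle.
  pose proof (Rmax_l (Rabs (fst z)) (Rabs (snd z))). pose proof (Rmax_r (Rabs (fst z)) (Rabs (snd z))).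
  fold m in H, H0. pose proof (sqrt_sum_le (fst z) (snd z)). fold (nrm z) in H3. lra. }
assert (Hmn : m <= nrm z) by (apply Rmax_lub; assumption).
destruct (Rlt_le_dec m 1) as [L|L].
- pose proof (gP z ltac:(split; assumption)) as E. fold m in E.
  assert (/ nrm z <= g z).
  { replace (g z) with (/ m); [apply Rinv_le_contravar; lra|].
    apply Rmult_eq_reg_r with m; [|lra]. rewrite E. field; lra. }
  lra.
- assert (/ nrm z <= 1) by (rewrite <- Rinv_1; apply Rinv_le_contravar; lra). lra.
Qed.

Lemma scales_translate x : scales 1 (fun z => padd z x).
Proof.
pose proof (scales_diag (fst x) (snd x) 1 1 ltac:(lra) ltac:(lra)) as H.
rewrite Rabs_R1, Rinv_1, Rmult_1_r in H.
refine (scales_eq _ _ _ _ H). intros p; unfold padd; f_equal; ring.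
Qed.

Lemma meas_kern alpha x : meas (fun z => kern alpha (dist2 z x)).
Proof.
pose proof (meas_comp (scales_translate (- fst x, - snd x)) (meas_kern_nrm alpha)) as H.
replace (fun z => kern alpha (dist2 z x)) with (fun p => kern alpha (nrm (padd p (- fst x, - snd x)))).
- exact H.
- apply funext; intros z. reflexivity.
Qed.

Lemma pot_translated O alpha x : 1 < alpha < 3 -> closed_set O -> bounded_set O ->
  summable (fun z => charf (O (padd z x)) * kern alpha (nrm z)) /\
  summable (fun z => charf (O z) * kern alpha (dist2 z x)) /\
  pot O alpha x = int2 (fun z => charf (O (padd z x)) * kern alpha (nrm z)).
Proof.
intros Ha Hc Hb.
destruct (potential_dominator O alpha (Rmax (Rabs (fst x)) (Rabs (snd x))) Ha Hb) as [G [sG HG]].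
{ eapply Rle_trans; [apply Rabs_pos|apply Rmax_l]. }
assert (s1 : summable (fun z => charf (O (padd z x)) * kern alpha (nrm z))).
{ refine (summable_le _ sG _).
  - apply meas_mult; [|apply meas_kern_nrm].
    exact (meas_comp (scales_translate x) (closed_meas O Hc)).
  - intros z. apply HG; [apply Rmax_l|apply Rmax_r]. }
split; [exact s1|].
destruct (int_change (scales_translate (- fst x, - snd x)) s1) as [s2 e2].
assert (E : (fun p => charf (O (padd (padd p (- fst x, - snd x)) x)) * kern alpha (nrm (padd p (- fst x, - snd x)))) =
  (fun z => charf (O z) * kern alpha (dist2 z x))).
{ apply funext; intros z. f_equal. f_equal. f_equal.
  unfold padd; destruct z; simpl; f_equal; ring. }
rewrite E in s2, e2. split; [exact s2|]. unfold pot. rewrite e2. ring.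
Qed.

Lemma boundary_continuity O p : closed_set O -> ~ boundary_pt O p ->
  exists e, 0 < e /\ forall q, dist2 p q < e -> (O q <-> O p).
Proof.
intros Hc Hp. destruct (excluded_middle_informative (O p)) as [Ho|Ho].
- assert (Hi : interior_pt O p) by (apply NNPP; intros h; apply Hp; split; assumption).
  destruct Hi as [e [He Hq]]. exists e. split; [exact He|]. intros q h; split; auto.
- destruct (Hc p Ho) as [e [He Hq]]. exists e. split; [exact He|].
  intros q h. split; intros k; [exfalso; exact (Hq q h k)|contradiction].
Qed.

Lemma charf_iff (P Q : Prop) : (P <-> Q) -> charf P = charf Q.
Proof.
intros H. unfold charf. repeat destruct (excluded_middle_informative _); try lra; exfalso; tauto.
Qed.

(** In translated form the integrand depends on the center only through the indicator of O, which is
    locally constant off the boundary. A sequence of bad points at distance below 1/(n+1) would then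
    contradict dominated convergence. *)
Lemma pot_continuity O alpha x eps : 1 < alpha < 3 -> convex_body O -> 0 < eps ->
  exists d, 0 < d /\ forall y, dist2 x y < d -> Rabs (pot O alpha y - pot O alpha x) < eps.
Proof.
intros Ha HO He. pose proof (boundary_null O HO) as Hn.
destruct HO as [_ [Hc [Hb _]]].
apply NNPP; intros Hno.
assert (Hbad : forall n : nat, exists y, dist2 x y < / (INR n + 1) /\
   ~ Rabs (pot O alpha y - pot O alpha x) < eps).
{ intros n. apply NNPP; intros Hm. apply Hno. exists (/ (INR n + 1)). split.
  - apply Rinv_0_lt_compat. pose proof (pos_INR n); lra.
  - intros y Hy. apply NNPP; intros Hy2. apply Hm. exists y. split; assumption. }
pose (y n := proj1_sig (ClassicalEpsilon.constructive_indefinite_description _ (Hbad n))).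
assert (Hy : forall n, dist2 x (y n) < / (INR n + 1) /\ ~ Rabs (pot O alpha (y n) - pot O alpha x) < eps).
{ intros n. exact (proj2_sig (ClassicalEpsilon.constructive_indefinite_description _ (Hbad n))). }
clearbody y.
pose (X := Rmax (Rabs (fst x)) (Rabs (snd x)) + 1).
pose proof (Rmax_l (Rabs (fst x)) (Rabs (snd x))) as M1.
pose proof (Rmax_r (Rabs (fst x)) (Rabs (snd x))) as M2.
pose proof (Rabs_pos (fst x)) as M3.
assert (Hinv : forall n, / (INR n + 1) <= 1).
{ intros n. rewrite <- Rinv_1. apply Rinv_le_contravar; [lra|]. pose proof (pos_INR n); lra. }
assert (HyX : forall n, Rabs (fst (y n)) <= X /\ Rabs (snd (y n)) <= X).
{ intros n. destruct (Hy n) as [h _]. pose proof (Hinv n).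
  pose proof (dist2_ge_fst x (y n)) as D1. pose proof (dist2_ge_snd x (y n)) as D2.
  pose proof (Rabs_triang_inv (fst (y n)) (fst x)) as T1.
  pose proof (Rabs_triang_inv (snd (y n)) (snd x)) as T2.
  rewrite Rabs_minus_sym in D1, D2. unfold X. lra. }
destruct (potential_dominator O alpha X Ha Hb) as [G [sG HG]]; [unfold X; lra|].
destruct (pot_translated O alpha x Ha Hc Hb) as [sx [_ ex]].
destruct (int_dct (fn := fun n z => charf (O (padd z (y n))) * kern alpha (nrm z))
  (f := fun z => charf (O (padd z x)) * kern alpha (nrm z)) (g := G)
  (N := fun z => boundary_pt O (padd z x))) with (eps := eps) as [n0 Hn0].
- intros n. apply summable_meas, pot_translated; assumption.
- apply summable_meas, sx.
- exact (null_comp (scales_translate x) Hn).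
- intros z Hz e Hepos. destruct (boundary_continuity O _ Hc Hz) as [d [Hd Hq]].
  destruct (INR_unbounded (/ d)) as [n0 Hn0]. exists n0. intros n Hnn.
  rewrite (charf_iff (O (padd z (y n))) (O (padd z x))); [rewrite Rminus_diag, Rabs_R0; exact Hepos|].
  apply Hq.
  replace (dist2 (padd z x) (padd z (y n))) with (dist2 x (y n)).
  2:{ unfold dist2, padd; simpl. f_equal. ring. }
  eapply Rlt_trans; [apply Hy|].
  rewrite <- (Rinv_inv d). apply Rinv_lt_contravar.
  + apply Rmult_lt_0_compat; [apply Rinv_0_lt_compat; lra|pose proof (pos_INR n); lra].
  + apply le_INR in Hnn. lra.
- intros n z. apply HG; apply HyX.
- exact sG.
- exact He.
- apply (proj2 (Hy n0)). specialize (Hn0 n0 (le_n _)). cbv beta in Hn0.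
  rewrite ex. rewrite (proj2 (proj2 (pot_translated O alpha (y n0) Ha Hc Hb))). exact Hn0.
Qed.

Definition trunc (O : pt -> Prop) (alpha : R) (x : pt) (M : R) (z : pt) : R :=
  charf (O z) * Rmin (kern alpha (dist2 z x)) M.

Lemma Rabs_Rmin_lipschitz a b M : Rabs (Rmin a M - Rmin b M) <= Rabs (a - b).
Proof.
unfold Rmin; destruct (Rle_dec a M), (Rle_dec b M);
  unfold Rabs; repeat destruct (Rcase_abs _); lra.
Qed.

Lemma kern_dist_continuity alpha x p eps : p <> x -> 0 < eps -> exists d, 0 < d /\
  forall q, dist2 p q < d -> Rabs (kern alpha (dist2 q x) - kern alpha (dist2 p x)) < eps.
Proof.
intros Hp He.
assert (Hr : 0 < dist2 p x).
{ destruct (dist2_pos p x) as [h|h]; [exact h|]. exfalso; apply Hp, dist2_eq0; auto. }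
destruct (kern_continuity alpha _ Hr eps He) as [d [Hd H]]. exists d. split; [exact Hd|].
intros q Hq. destruct (Req_dec (dist2 q x) (dist2 p x)) as [e|ne].
- rewrite e, Rminus_diag, Rabs_R0. exact He.
- apply (H (dist2 q x)). split.
  + split; [exact I|]. auto.
  + simpl. unfold Rdist. eapply Rle_lt_trans; [|exact Hq].
    pose proof (dist2_tri q p x). pose proof (dist2_tri p q x). rewrite (dist2_sym q p) in H0.
    apply Rabs_le. lra.
Qed.

(** The kernel is bounded below on bounded sets, so capping it at M makes the integrand bounded; its
    discontinuities lie on the boundary of O or at x. *)
Lemma trunc_riemann O alpha x M R0 : 1 < alpha < 3 -> convex_body O -> 0 < R0 ->
  (forall p, O p -> Rabs (fst p) < R0 /\ Rabs (snd p) < R0) ->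
  summable (trunc O alpha x M) /\ square_integral (trunc O alpha x M) R0 (int2 (trunc O alpha x M)).
Proof.
intros Ha HO HR HO2. pose proof (boundary_null O HO) as Hn.
destruct HO as [_ [Hc [Hb _]]].
(* L bounds the distance from x to any point of O, so - L bounds the kernel from below there. *)
pose (L := 2 * R0 + Rabs (fst x) + Rabs (snd x)).
pose proof (Rabs_pos (fst x)) as X1. pose proof (Rabs_pos (snd x)) as X2.
pose proof (Rabs_pos M) as X3. pose proof (Rle_abs M) as X4.
assert (HL : forall z, Rabs (trunc O alpha x M z) <= (L + Rabs M) * char_of O z).
{ intros z. unfold trunc, char_of. rewrite Rabs_mult, Rmult_comm.
  pose proof (charf_01 (O z)).
  rewrite (Rabs_right (charf (O z))) by lra.
  destruct (excluded_middle_informative (O z)) as [Hz|Hz]; [|rewrite charfF by exact Hz; lra].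
  rewrite charfT by exact Hz. rewrite !Rmult_1_r.
  assert (Hk : - L <= kern alpha (dist2 z x)).
  { destruct (dist2_pos z x) as [h|h].
    - destruct (kern_bound alpha _ Ha h) as [_ h1]. destruct (HO2 z Hz).
      pose proof (dist2_le z x). pose proof (Rabs_triang (fst z) (- fst x)).
      pose proof (Rabs_triang (snd z) (- snd x)). rewrite Rabs_Ropp in H3, H4.
      unfold Rminus in H2. unfold L. lra.
    - rewrite <- h. pose proof (kern_0 alpha). unfold L; lra. }
  assert (0 <= L) by (unfold L; lra).
  pose proof (Rmin_r (kern alpha (dist2 z x)) M).
  assert (- (L + Rabs M) <= Rmin (kern alpha (dist2 z x)) M).
  { apply Rmin_glb; [lra|]. pose proof (Rle_abs (- M)). rewrite Rabs_Ropp in H2. lra. }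
  apply Rabs_le. lra. }
assert (sO : summable (char_of O)).
{ apply (char_of_summable O R0); auto using closed_meas; lra. }
assert (s : summable (trunc O alpha x M)).
{ refine (summable_le _ (proj1 (int_scal (L + Rabs M) sO)) HL).
  apply meas_mult; [exact (closed_meas O Hc)|]. apply meas_min; [apply meas_kern|apply meas_cst]. }
split; [exact s|].
apply (riemann_integral _ R0 (L + Rabs M) (fun z => boundary_pt O z \/ z = x) HR s).
- apply null_or; [exact Hn|apply null_point].
- intros z. eapply Rle_trans; [apply HL|]. pose proof (charf_01 (O z)).
  unfold char_of. assert (0 <= L) by (unfold L; lra). nra.
- intros z Hz. apply HO2. apply NNPP; intros h. apply Hz. unfold trunc. rewrite charfF by exact h. ring.
- intros p Hp eps He.
  destruct (boundary_continuity O p Hc ltac:(tauto)) as [d1 [Hd1 H1]].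
  destruct (kern_dist_continuity alpha x p eps ltac:(tauto) He) as [d2 [Hd2 H2]].
  exists (Rmin d1 d2 / 2). split; [apply Rdiv_lt_0_compat; [apply Rmin_pos; lra|lra]|].
  intros q Q1 Q2. pose proof (dist2_lt_box p q (Rmin d1 d2) Q1 Q2) as Hq.
  pose proof (Rmin_l d1 d2). pose proof (Rmin_r d1 d2).
  unfold trunc. rewrite (charf_iff (O q) (O p)) by (apply H1; lra).
  rewrite <- Rmult_minus_distr_l, Rabs_mult.
  pose proof (charf_01 (O p)). rewrite (Rabs_right (charf _)) by lra.
  pose proof (Rabs_Rmin_lipschitz (kern alpha (dist2 q x)) (kern alpha (dist2 p x)) M).
  pose proof (H2 q ltac:(lra)). pose proof (Rabs_pos (Rmin (kern alpha (dist2 q x)) M - Rmin (kern alpha (dist2 p x)) M)). nra.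
Qed.

(** Dominated convergence gives the limit along integer M, and monotonicity in M extends it to all
    real M. *)
Lemma trunc_cvg O alpha x : 1 < alpha < 3 -> convex_body O ->
  forall eps, 0 < eps -> exists M0, forall M, M0 <= M ->
    Rabs (int2 (trunc O alpha x M) - pot O alpha x) < eps.
Proof.
intros Ha HO eps He.
destruct (bounded_in_box O (proj1 (proj2 (proj2 HO)))) as [B [HB HOB]].
assert (st : forall M, summable (trunc O alpha x M)) by (intros M; apply (trunc_riemann O alpha x M B); auto).
destruct HO as [_ [Hc [Hb _]]].
destruct (pot_translated O alpha x Ha Hc Hb) as [_ [s _]].
assert (sabs : summable (fun z => Rabs (charf (O z) * kern alpha (dist2 z x)))).
{ apply summable_abs; exact s. }
assert (Hle : forall M z, trunc O alpha x M z <= charf (O z) * kern alpha (dist2 z x)).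
{ intros M z. unfold trunc. apply Rmult_le_compat_l; [apply charf_01|apply Rmin_l]. }
destruct (int_dct (fn := fun n => trunc O alpha x (INR n))
  (f := fun z => charf (O z) * kern alpha (dist2 z x))
  (g := fun z => Rabs (charf (O z) * kern alpha (dist2 z x)))
  (N := fun z => z = x)) with (eps := eps) as [n0 Hn0].
- intros n. apply summable_meas, st.
- apply summable_meas, s.
- apply null_point.
- intros p _ e Hp. destruct (INR_unbounded (kern alpha (dist2 p x))) as [n0 Hn0].
  exists n0. intros n Hn. apply le_INR in Hn. unfold trunc.
  rewrite Rmin_left by lra. rewrite Rminus_diag, Rabs_R0. exact Hp.
- intros n p. unfold trunc. rewrite !Rabs_mult. apply Rmult_le_compat_l; [apply Rabs_pos|].
  pose proof (pos_INR n). unfold Rmin. destruct (Rle_dec _ _) as [h|h]; [lra|].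
  rewrite Rabs_right by lra. pose proof (Rle_abs (kern alpha (dist2 p x))). lra.
- exact sabs.
- exact He.
- exists (INR n0). intros M HM. specialize (Hn0 n0 (le_n _)). cbv beta in Hn0.
  fold (pot O alpha x) in Hn0.
  assert (int2 (trunc O alpha x (INR n0)) <= int2 (trunc O alpha x M)).
  { apply int_le; auto. intros z. unfold trunc. apply Rmult_le_compat_l; [apply charf_01|].
    apply Rle_min_compat_l; exact HM. }
  assert (int2 (trunc O alpha x M) <= pot O alpha x) by (apply int_le; auto).
  apply Rabs_def2 in Hn0. apply Rabs_def1; lra.
Qed.

Lemma square_integral_unique g R0 v w : 0 < R0 ->
  square_integral g R0 v -> square_integral g R0 w -> v = w.
Proof.
intros HR Hv Hw. apply NNPP; intros Hne.
assert (He : 0 < Rabs (v - w) / 2) by (apply Rdiv_lt_0_compat; [apply Rabs_pos_lt; lra|lra]).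
destruct (Hv _ He) as [N1 H1]. destruct (Hw _ He) as [N2 H2].
pose (n := S (N1 + N2)).
pose (tag := fun i j : nat => (- R0 + INR i * (2 * R0 / INR n), - R0 + INR j * (2 * R0 / INR n))).
assert (Ht : forall i j, (i < n)%coq_nat -> (j < n)%coq_nat -> in_cell R0 n i j (tag i j)).
{ intros i j _ _. unfold in_cell, tag.
  assert (Hh : 0 < 2 * R0 / INR n).
  { apply Rdiv_lt_0_compat; [lra|]. apply lt_0_INR. unfold n; lia. }
  clearbody n. set (h := 2 * R0 / INR n) in *. clearbody h. cbv zeta. cbn [fst snd].
  repeat split; rewrite ?S_INR; lra. }
pose proof (H1 n ltac:(unfold n; lia) ltac:(unfold n; lia) tag Ht) as A1.
pose proof (H2 n ltac:(unfold n; lia) ltac:(unfold n; lia) tag Ht) as A2.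
set (S := sumN _ _ * _) in *.
pose proof (Rabs_triang (v - S) (S - w)) as T. rewrite (Rabs_minus_sym v S) in T.
replace (v - S + (S - w)) with (v - w) in T by ring. lra.
Qed.

(** [V_is] leaves the enclosing square and the truncated integrals free; both directions together
    show that every point has exactly one value, so [is_center] becomes a statement about [pot]. *)
Lemma V_isE O alpha x v : 1 < alpha < 3 -> convex_body O ->
  V_is O alpha x v <-> v = pot O alpha x.
Proof.
intros Ha HO.
assert (E : forall M, (fun y => match excluded_middle_informative (O y) with
     left _ => Rmin (Defs.kernel alpha x y) M | right _ => 0 end) = trunc O alpha x M).
{ intros M. apply funext; intros y. unfold trunc, charf. rewrite kernelE.
  destruct (excluded_middle_informative (O y)); ring. }
split.
- intros [R0 [HR [HO2 [J [H1 H2]]]]].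
  apply NNPP; intros Hne.
  assert (He : 0 < Rabs (v - pot O alpha x) / 2) by (apply Rdiv_lt_0_compat; [apply Rabs_pos_lt; lra|lra]).
  destruct (H2 _ He) as [M1 HM1]. destruct (trunc_cvg O alpha x Ha HO _ He) as [M2 HM2].
  pose (M := Rmax M1 M2).
  specialize (HM1 M (Rmax_l _ _)). specialize (HM2 M (Rmax_r _ _)).
  assert (e : J M = int2 (trunc O alpha x M)).
  { apply (square_integral_unique (trunc O alpha x M) R0); [exact HR| |].
    - rewrite <- E. exact (H1 M).
    - apply trunc_riemann; auto. }
  rewrite e in HM1.
  set (S := int2 _) in *.
  pose proof (Rabs_triang (v - S) (S - pot O alpha x)) as T. rewrite (Rabs_minus_sym v S) in T.
  replace (v - S + (S - pot O alpha x)) with (v - pot O alpha x) in T by ring. lra.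
- intros ->. destruct (bounded_in_box O (proj1 (proj2 (proj2 HO)))) as [B [HB HOB]].
  exists B. split; [exact HB|]. split; [exact HOB|].
  exists (fun M => int2 (trunc O alpha x M)). split; [|apply trunc_cvg; assumption].
  intros M. pose proof (proj2 (trunc_riemann O alpha x M B Ha HO HB HOB)) as H.
  rewrite <- E in H. rewrite <- E. exact H.
Qed.

(** * Comparing the potential at two points *)

Lemma int_gt0_near f N z0 e : summable f -> null N -> (forall p, ~ N p -> 0 <= f p) ->
  0 < e -> (forall p, dist2 z0 p < e -> ~ N p -> 0 < f p) -> 0 < int2 f.
Proof.
intros hf hN h0 He hp.
apply (int_gt0_ae (a := fst z0) (b := fst z0 + e / 2) (c := snd z0) (d := snd z0 + e / 2) hf hN h0);
  try lra.
intros p h1 h2 Hp. apply hp; [|exact Hp]. apply dist2_lt_box; rewrite Rabs_right; lra.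
Qed.

(** Positive where z is nearer to x than to y, except possibly at z = x. *)
Definition kdiff (alpha : R) (x y z : pt) : R :=
  ksign alpha * (kern alpha (dist2 z x) - kern alpha (dist2 z y)).

(** Comparing squared distances keeps the bisector conditions polynomial, within reach of [ring] and
    [nra]. *)
Definition sqd (p q : pt) : R := (fst p - fst q) ^ 2 + (snd p - snd q) ^ 2.

Lemma sqd_pos p q : 0 <= sqd p q.
Proof. unfold sqd. pose proof (pow2_ge_0 (fst p - fst q)). pose proof (pow2_ge_0 (snd p - snd q)). lra. Qed.

(** The point z = x is excluded because monotonicity can fail at distance 0, where the kernel has
    its junk value. *)
Lemma kdiff_pos alpha x y z : z <> x -> sqd z x < sqd z y -> 0 < kdiff alpha x y z.
Proof.
intros Hne H. unfold kdiff.
assert (dist2 z x < dist2 z y) by (apply sqrt_lt_1_alt; split; [apply sqd_pos|exact H]).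
assert (0 < dist2 z x).
{ destruct (dist2_pos z x) as [h|h]; [exact h|]. exfalso. apply Hne, dist2_eq0. auto. }
pose proof (kern_decr alpha (dist2 z x) (dist2 z y) ltac:(lra)). lra.
Qed.

Lemma kdiff_opp alpha x y z : kdiff alpha x y z = - kdiff alpha y x z.
Proof. unfold kdiff; ring. Qed.

Lemma kdiff_neg alpha x y z : z <> y -> sqd z y < sqd z x -> kdiff alpha x y z < 0.
Proof. intros h1 h2. rewrite kdiff_opp. pose proof (kdiff_pos alpha y x z h1 h2). lra. Qed.

Lemma kdiff_0 alpha x y z : sqd z x = sqd z y -> kdiff alpha x y z = 0.
Proof.
intros H. unfold kdiff. replace (dist2 z x) with (dist2 z y); [ring|].
unfold dist2. f_equal. symmetry. exact H.
Qed.

Definition spot (O : pt -> Prop) (alpha : R) (x : pt) : R := ksign alpha * pot O alpha x.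

Lemma spot_diff O alpha x y : 1 < alpha < 3 -> closed_set O -> bounded_set O ->
  summable (fun z => charf (O z) * kdiff alpha x y z) /\
  int2 (fun z => charf (O z) * kdiff alpha x y z) = spot O alpha x - spot O alpha y.
Proof.
intros Ha Hc Hb.
destruct (pot_translated O alpha x Ha Hc Hb) as [_ [s1 _]].
destruct (pot_translated O alpha y Ha Hc Hb) as [_ [s2 _]].
destruct (int_minus s1 s2) as [s3 e3].
destruct (int_scal (ksign alpha) s3) as [s4 e4].
assert (E : (fun z => charf (O z) * kdiff alpha x y z) =
  (fun p => ksign alpha * (charf (O p) * kern alpha (dist2 p x) - charf (O p) * kern alpha (dist2 p y)))).
{ apply funext; intros z. unfold kdiff. ring. }
rewrite E. split; [exact s4|]. rewrite e4, e3. unfold spot, pot. ring.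
Qed.

(** * Bodies symmetric in the first axis: points off the axis and beyond its ends *)

Definition xsym (O : pt -> Prop) := forall x y, O (x, y) -> O (x, - y).

(** Vertical sections are segments centered on the axis: (x, v) is a convex combination of (x, w)
    and its mirror image. *)
Lemma vertical O x v w : convex_set O -> xsym O -> O (x, w) -> Rabs v <= Rabs w -> O (x, v).
Proof.
intros HC HS Hw Hv.
destruct (Req_dec w 0) as [e|ne].
{ subst w. rewrite Rabs_R0 in Hv. replace v with 0; [exact Hw|].
  pose proof (Rle_abs v). pose proof (Rle_abs (- v)). rewrite Rabs_Ropp in H0. lra. }
assert (Hvw : -1 <= v / w <= 1).
{ assert (H : Rabs (v / w) <= 1).
  { unfold Rdiv. rewrite Rabs_mult, Rabs_inv.
    pose proof (Rabs_pos_lt w ne). apply Rmult_le_reg_r with (Rabs w); [lra|].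
    rewrite Rmult_assoc, Rinv_l; lra. }
  pose proof (Rle_abs (v / w)). pose proof (Rle_abs (- (v / w))). rewrite Rabs_Ropp in H1. lra. }
pose proof (HC (x, w) (x, - w) ((1 + v / w) / 2) Hw (HS _ _ Hw) ltac:(lra)) as H. cbn [fst snd] in H.
replace (x, v) with ((1 + v / w) / 2 * x + (1 - (1 + v / w) / 2) * x,
  (1 + v / w) / 2 * w + (1 - (1 + v / w) / 2) * - w); [exact H|].
f_equal; field; exact ne.
Qed.

Lemma axis_point O x v : convex_set O -> xsym O -> O (x, v) -> O (x, 0).
Proof. intros HC HS H. apply (vertical O x 0 v HC HS H). rewrite Rabs_R0. apply Rabs_pos. Qed.

Lemma interior_near O z e : convex_body O -> O z -> 0 < e ->
  exists c, interior_pt O c /\ Rabs (fst c - fst z) < e /\ Rabs (snd c - snd z) < e.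
Proof.
intros [HC [_ [_ [p0 Hp0]]]] Hz He.
pose (m := Rabs (fst z - fst p0) + Rabs (snd z - snd p0) + 1).
pose proof (Rabs_pos (fst z - fst p0)) as A1. pose proof (Rabs_pos (snd z - snd p0)) as A2.
pose (d := Rmin (e / (2 * m)) 1).
assert (Hd : 0 < d <= 1).
{ split; [apply Rmin_pos; [apply Rdiv_lt_0_compat; unfold m; lra|lra]|apply Rmin_r]. }
assert (Hdm : d * m < e).
  { assert (H : d <= e / (2 * m)) by apply Rmin_l.
  apply Rle_lt_trans with (e / (2 * m) * m); [apply Rmult_le_compat_r; [unfold m; lra|exact H]|].
  replace (e / (2 * m) * m) with (e / 2) by (field; unfold m; lra). lra. }
exists ((1 - d) * fst z + (1 - (1 - d)) * fst p0, (1 - d) * snd z + (1 - (1 - d)) * snd p0).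
split; [apply interior_combination; auto; lra|]. cbn [fst snd]. split.
- replace ((1 - d) * fst z + (1 - (1 - d)) * fst p0 - fst z) with (- (d * (fst z - fst p0))) by ring.
  rewrite Rabs_Ropp, Rabs_mult, (Rabs_right d) by lra. unfold m in Hdm. nra.
- replace ((1 - d) * snd z + (1 - (1 - d)) * snd p0 - snd z) with (- (d * (snd z - snd p0))) by ring.
  rewrite Rabs_Ropp, Rabs_mult, (Rabs_right d) by lra. unfold m in Hdm. nra.
Qed.

Lemma dist2_small_comp p q e : dist2 p q < e -> Rabs (fst q - fst p) < e /\ Rabs (snd q - snd p) < e.
Proof.
intros H. pose proof (dist2_ge_fst p q). pose proof (dist2_ge_snd p q).
rewrite (Rabs_minus_sym (fst q)), (Rabs_minus_sym (snd q)). lra.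
Qed.

(* Antisymmetry of kdiff under the reflection rho in the perpendicular bisector turns the
   integral over O into half the integral of (1_O - 1_{rho O}) * kdiff. *)
Lemma spot_off_axis O alpha p q : 1 < alpha < 3 -> convex_body O -> xsym O -> q <> 0 ->
  spot O alpha (p, q) < spot O alpha (p, 0).
Proof.
intros Ha HO HS Hq. pose proof HO as [HC [Hc [Hb _]]].
pose (x := (p, 0)). pose (y := (p, q)). pose (rho := fun z : pt => (fst z, q - snd z)).
destruct (spot_diff O alpha x y Ha Hc Hb) as [s1 e1].
assert (Hrho : scales 1 rho).
{ pose proof (scales_diag 0 q 1 (-1) ltac:(lra) ltac:(lra)) as H.
  rewrite Rabs_R1, Rabs_left in H by lra.
  replace (/ 1 * / - -1) with 1 in H by field.
  refine (scales_eq _ _ _ _ H). intros z; unfold rho; f_equal; ring. }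
destruct (int_change Hrho s1) as [s2 e2].
destruct (int_plus s1 s2) as [s3 e3].
assert (Hk : forall z, kdiff alpha x y (rho z) = - kdiff alpha x y z).
{ intros z. rewrite <- kdiff_opp. unfold kdiff.
  replace (dist2 (rho z) x) with (dist2 z y); [replace (dist2 (rho z) y) with (dist2 z x); [reflexivity|]|];
  unfold dist2, rho, x, y; cbn [fst snd]; f_equal; ring. }
destruct (completeness (fun v => exists a, O (a, v))) as [T [HT1 HT2]].
{ destruct (bounded_in_box O Hb) as [B [HB HOB]]. exists B. intros v [a Hv].
  destruct (HOB _ Hv) as [_ h]. cbn in h. pose proof (Rle_abs v). lra. }
{ destruct HO as [_ [_ [_ [p0 [e [He Hp0]]]]]]. exists (snd p0), (fst p0). rewrite <- surjective_pairing.
  apply Hp0. unfold dist2. rewrite !Rminus_diag. replace (0 ^ 2 + 0 ^ 2) with 0 by ring. rewrite sqrt_0; lra. }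
assert (HTabs : forall z, O z -> Rabs (snd z) <= T).
{ intros [z1 z2] Hz. cbn. apply Rabs_le. split.
  - pose proof (HT1 (- z2) (ex_intro _ z1 (HS _ _ Hz))). lra.
  - apply HT1. exists z1; exact Hz. }
pose proof (Rabs_pos_lt q Hq) as Hqa.
(* With T the greatest height of O, a point almost at height T on the side of the axis away from (p,
   q) is reflected beyond height T, hence out of O. The margin |q|/2 is spent in two halves: on
   moving into the interior and on the radius of the ball. *)
assert (Hc0 : exists z0 e, 0 < e /\ forall z, dist2 z0 z < e -> O z /\ ~ O (rho z)).
{ assert (Hz : exists a v, O (a, v) /\ T - Rabs q / 2 < v).
  { apply NNPP; intros h. assert (T <= T - Rabs q / 2); [|lra]. apply HT2. intros v [a Hv].
    apply Rnot_lt_le; intros h2. apply h. exists a, v. split; assumption. }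
  destruct Hz as [a [v [Hz Hv]]].
  assert (Hz' : exists w, O (a, w) /\ T + Rabs q / 2 < Rabs (q - w)).
  { destruct (Rlt_le_dec 0 q) as [L|L].
    - exists (- v). split; [apply HS; exact Hz|]. rewrite (Rabs_right q) in * by lra.
      eapply Rlt_le_trans; [|apply Rle_abs]. lra.
    - exists v. split; [exact Hz|]. rewrite (Rabs_left q) in * by lra.
      rewrite <- Rabs_Ropp. eapply Rlt_le_trans; [|apply Rle_abs]. lra. }
  destruct Hz' as [w [Hw HTw]].
  destruct (interior_near O (a, w) (Rabs q / 4) HO Hw ltac:(lra)) as [c [[e [He Hce]] [_ Hc2]]].
  exists c, (Rmin e (Rabs q / 4)). split; [apply Rmin_pos; lra|].
  intros z Hz2. pose proof (Rmin_l e (Rabs q / 4)). pose proof (Rmin_r e (Rabs q / 4)).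
  split; [apply Hce; lra|]. intros Hr. pose proof (HTabs _ Hr) as Hr2. unfold rho in Hr2; cbn [fst snd] in *.
  destruct (dist2_small_comp _ _ _ Hz2) as [_ Hz3].
  assert (Rabs (q - w) <= Rabs (q - snd z) + Rabs (snd z - snd c) + Rabs (snd c - w)).
  { replace (q - w) with ((q - snd z) + (snd z - snd c) + (snd c - w)) by ring.
    eapply Rle_trans; [apply Rabs_triang|]. apply Rplus_le_compat_r, Rabs_triang. }
  lra. }
destruct Hc0 as [z0 [e0 [He0 Hz0]]].
assert (Hsq : forall z, sqd z y - sqd z x = (q - snd z) ^ 2 - snd z ^ 2).
{ intros z. unfold sqd, x, y; cbn [fst snd]. ring. }
(* The hypothesis says that z is at least as near to x as to y. The reflection then moves z away
   from the axis in its own vertical section, so 1_O - 1_{rho O} has the sign of [kdiff]. *)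
assert (Hmon : forall z, Rabs (snd z) <= Rabs (q - snd z) -> O (rho z) -> O z).
{ intros [z1 z2] h Hr. exact (vertical O z1 z2 (q - z2) HC HS Hr h). }
assert (Hmon2 : forall z, Rabs (q - snd z) <= Rabs (snd z) -> O z -> O (rho z)).
{ intros [z1 z2] h Hr. exact (vertical O z1 (q - z2) z2 HC HS Hr h). }
assert (Habs : forall a b, a ^ 2 <= b ^ 2 -> Rabs a <= Rabs b).
{ intros a b h. apply Rsqr_le_abs_0. unfold Rsqr. lra. }
assert (Hgt : 0 < int2 (fun z => charf (O z) * kdiff alpha x y z + charf (O (rho z)) * kdiff alpha x y (rho z))).
{ apply (int_gt0_near _ (fun z => z = x \/ z = y) z0 e0 s3).
  - apply null_or; apply null_point.
  - intros z Hz. rewrite Hk. specialize (Hsq z).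
    replace (charf (O z) * kdiff alpha x y z + charf (O (rho z)) * - kdiff alpha x y z) with
      ((charf (O z) - charf (O (rho z))) * kdiff alpha x y z) by ring.
    destruct (Rtotal_order (sqd z x) (sqd z y)) as [h|[h|h]].
    + pose proof (kdiff_pos alpha x y z ltac:(tauto) h).
      pose proof (charf_le _ _ (Hmon z (Habs (snd z) (q - snd z) ltac:(lra)))). nra.
    + rewrite (kdiff_0 _ _ _ _ h). lra.
    + pose proof (kdiff_neg alpha x y z ltac:(tauto) h).
      pose proof (charf_le _ _ (Hmon2 z (Habs (q - snd z) (snd z) ltac:(lra)))). nra.
  - exact He0.
  - intros z Hz Hn. rewrite Hk. specialize (Hsq z). destruct (Hz0 z Hz) as [h1 h2].
    rewrite (charfT h1), (charfF h2).
    enough (0 < kdiff alpha x y z) by lra. apply kdiff_pos; [tauto|].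
    apply Rnot_le_lt; intros h. apply h2, Hmon2; [|exact h1]. apply Habs. lra. }
rewrite e3, e2, e1 in Hgt. unfold x, y in Hgt. lra.
Qed.

(** The sign s selects the right or the left end. The supremum is attained on the axis because every
    point of O projects vertically to an axis point of O and O is closed. *)
Lemma axis_end O s : convex_body O -> xsym O -> s * s = 1 ->
  exists m, O (s * m, 0) /\ forall z, O z -> s * fst z <= m.
Proof.
intros HO HS Hs. pose proof HO as [HC [Hc [Hb [p0 [e [He Hp0]]]]]].
destruct (completeness (fun v => exists z, O z /\ s * fst z = v)) as [m [Hm1 Hm2]].
{ destruct (bounded_in_box O Hb) as [B [HB HOB]]. exists B. intros v [z [Hz <-]].
  destruct (HOB _ Hz) as [h _]. pose proof (Rle_abs (s * fst z)). rewrite Rabs_mult in H.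
  replace (Rabs s) with 1 in H; [lra|]. symmetry. rewrite <- sqrt_Rsqr_abs. unfold Rsqr. rewrite Hs. apply sqrt_1. }
{ exists (s * fst p0), p0. split; [|reflexivity].
  apply Hp0. unfold dist2. rewrite !Rminus_diag. replace (0 ^ 2 + 0 ^ 2) with 0 by ring. rewrite sqrt_0; lra. }
exists m. split; [|intros z Hz; apply Hm1; exists z; auto].
apply NNPP; intros Hno. destruct (Hc _ Hno) as [d [Hd Hf]].
assert (m <= m - d / 2); [|lra]. apply Hm2. intros v [z [Hz <-]].
apply Rnot_lt_le; intros Hlt.
assert (Hle : s * fst z <= m) by (apply Hm1; exists z; split; [exact Hz|reflexivity]).
apply (Hf (fst z, 0)).
- apply dist2_lt_box; cbn [fst snd]; [|rewrite Rminus_diag, Rabs_R0; lra].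
  replace (fst z - s * m) with (s * (s * fst z - m)) by (rewrite Rmult_minus_distr_l, <- Rmult_assoc, Hs; ring).
  rewrite Rabs_mult. replace (Rabs s) with 1; [rewrite Rmult_1_l; apply Rabs_def1; lra|].
  symmetry. rewrite <- sqrt_Rsqr_abs. unfold Rsqr. rewrite Hs. apply sqrt_1.
- destruct z as [z1 z2]. exact (axis_point O z1 z2 HC HS Hz).
Qed.

(** Every point of O is nearer to the end (s * m, 0) of the axis segment than to (p, 0). *)
Lemma spot_outside O alpha s m p : 1 < alpha < 3 -> convex_body O -> s * s = 1 ->
  (forall z, O z -> s * fst z <= m) -> m < s * p ->
  spot O alpha (p, 0) < spot O alpha (s * m, 0).
Proof.
intros Ha HO Hs Hm Hp. pose proof HO as [HC [Hc [Hb [p0 [e [He Hp0]]]]]].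
destruct (spot_diff O alpha (s * m, 0) (p, 0) Ha Hc Hb) as [s1 e1].
assert (Hlt : forall z, O z -> z <> (s * m, 0) -> 0 < kdiff alpha (s * m, 0) (p, 0) z).
{ intros z Hz Hne. apply kdiff_pos; [exact Hne|]. pose proof (Hm z Hz).
  unfold sqd; cbn [fst snd].
  assert ((fst z - s * m) ^ 2 = (s * fst z - m) ^ 2).
  { replace (fst z - s * m) with (s * (s * fst z - m)) by (rewrite Rmult_minus_distr_l, <- Rmult_assoc, Hs; ring).
    rewrite Rpow_mult_distr. simpl (s ^ 2). rewrite Rmult_1_r, Hs. ring. }
  assert ((fst z - p) ^ 2 = (s * fst z - s * p) ^ 2).
  { replace ((s * fst z - s * p) ^ 2) with ((s * s) * (fst z - p) ^ 2) by ring. rewrite Hs; ring. }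
  rewrite H0, H1. nra. }
enough (0 < int2 (fun z => charf (O z) * kdiff alpha (s * m, 0) (p, 0) z)) by lra.
apply (int_gt0_near _ (fun z => z = (s * m, 0)) p0 e s1).
- apply null_point.
- intros z Hz. destruct (excluded_middle_informative (O z)) as [h|h].
  + rewrite (charfT h). pose proof (Hlt z h Hz). lra.
  + rewrite (charfF h). lra.
- exact He.
- intros z Hz Hn. rewrite (charfT (Hp0 z Hz)). pose proof (Hlt z (Hp0 z Hz) Hn). lra.
Qed.

(** * The potential along the axis *)

(** The midpoint of an interior point and its mirror image is an interior point on the axis; moving
    from it towards an end of the segment stays in the interior. *)
Lemma axis_interior O a b x : convex_body O -> xsym O -> O (a, 0) -> O (b, 0) -> a < x < b ->
  interior_pt O (x, 0).
Proof.
intros HO HS Hoa Hob Hx. pose proof HO as [HC [_ [_ [[p1 p2] Hp0]]]].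
assert (Hin : O (p1, - p2)).
{ apply HS. destruct Hp0 as [e [He Hp]]. apply Hp. unfold dist2. rewrite !Rminus_diag.
  replace (0 ^ 2 + 0 ^ 2) with 0 by ring. rewrite sqrt_0; lra. }
pose proof (interior_combination O _ _ (1/2) HC Hp0 Hin ltac:(lra)) as H. cbn [fst snd] in H.
replace (1 / 2 * p1 + (1 - 1 / 2) * p1, 1 / 2 * - p2 + (1 - 1 / 2) * p2) with (p1, 0) in H
  by (f_equal; field).
destruct (Rtotal_order x p1) as [L|[->|L]]; [|exact H|].
- pose proof (interior_combination O (a, 0) _ ((p1 - x) / (p1 - a)) HC H Hoa) as K. cbn [fst snd] in K.
  replace (x, 0) with ((p1 - x) / (p1 - a) * a + (1 - (p1 - x) / (p1 - a)) * p1,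
    (p1 - x) / (p1 - a) * 0 + (1 - (p1 - x) / (p1 - a)) * 0) by (f_equal; field; lra).
  apply K. split; [left; apply Rdiv_lt_0_compat; lra|].
  apply Rmult_lt_reg_r with (p1 - a); [lra|]. unfold Rdiv. rewrite Rmult_assoc, Rinv_l; lra.
- pose proof (interior_combination O (b, 0) _ ((x - p1) / (b - p1)) HC H Hob) as K. cbn [fst snd] in K.
  replace (x, 0) with ((x - p1) / (b - p1) * b + (1 - (x - p1) / (b - p1)) * p1,
    (x - p1) / (b - p1) * 0 + (1 - (x - p1) / (b - p1)) * 0) by (f_equal; field; lra).
  apply K. split; [left; apply Rdiv_lt_0_compat; lra|].
  apply Rmult_lt_reg_r with (b - p1); [lra|]. unfold Rdiv. rewrite Rmult_assoc, Rinv_l; lra.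
Qed.

(** The exit parameter is a supremum, attained because O is closed. The ray is parametrized by
    height, so t is also the ordinate of the exit point and lies below B. *)
Lemma ray_exit O y u B : closed_set O -> (forall p, O p -> Rabs (fst p) < B /\ Rabs (snd p) < B) ->
  interior_pt O (y, 0) ->
  exists t, 0 < t < B /\ O (y + u * t, t) /\ forall s, t < s -> ~ O (y + u * s, s).
Proof.
intros Hc HB [e [He Hp]]. pose proof (Rabs_pos u) as Hu.
pose (s0 := e / (2 * (Rabs u + 1))).
assert (Hs0 : 0 < s0) by (apply Rdiv_lt_0_compat; lra).
assert (Hs1 : s0 * (Rabs u + 1) = e / 2) by (unfold s0; field; lra).
assert (Hray : forall s t, dist2 (y + u * s, s) (y + u * t, t) <= Rabs (t - s) * (Rabs u + 1)).
{ intros s t. eapply Rle_trans; [apply dist2_le|]. cbn [fst snd].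
  replace (y + u * s - (y + u * t)) with (u * (s - t)) by ring.
  rewrite Rabs_mult, (Rabs_minus_sym t). lra. }
assert (Ho : O (y + u * s0, s0)).
{ apply Hp. replace (y, 0) with (y + u * 0, 0) by (f_equal; ring).
  eapply Rle_lt_trans; [apply Hray|]. rewrite Rminus_0_r, Rabs_right by lra. lra. }
destruct (completeness (fun s => O (y + u * s, s))) as [t [Ht1 Ht2]].
{ exists B. intros s Hs. destruct (HB _ Hs) as [_ h]. cbn in h. pose proof (Rle_abs s). lra. }
{ exists s0. exact Ho. }
exists t.
assert (Ht : O (y + u * t, t)).
{ apply NNPP; intros Hno. destruct (Hc _ Hno) as [d [Hd Hf]].
  pose (r := d / (2 * (Rabs u + 1))).
  assert (Hr0 : 0 < r) by (apply Rdiv_lt_0_compat; lra).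
  assert (Hr1 : r * (Rabs u + 1) = d / 2) by (unfold r; field; lra).
  assert (t <= t - r); [|lra]. apply Ht2. intros s Hs.
  apply Rnot_lt_le; intros Hlt. pose proof (Ht1 s Hs).
  apply (Hf (y + u * s, s)); [|exact Hs].
  eapply Rle_lt_trans; [apply Hray|]. rewrite Rabs_left1 by lra. nra. }
destruct (HB _ Ht) as [_ h]. cbn in h. pose proof (Rle_abs t). pose proof (Ht1 _ Ho).
split; [lra|]. split; [exact Ht|].
intros s Hs Hos. pose proof (Ht1 s Hos). lra.
Qed.

(* If (c', w) with w > t' were in O, a point of O further right would push the exit point of
   the ray beyond (c', t'); this bounds the profile of O at c' and hence, by concavity, on
   both sides. *)
Lemma homothety_shape O y eta c t c' t' u v :
  convex_set O -> xsym O -> 0 < eta -> 0 < t -> 0 < t' -> c < c' -> c' = y + eta * t' ->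
  O (c, t) -> (forall s, t' < s -> ~ O (y + eta * s, s)) -> 0 < u ->
  O (c' + t' / t * u, t' / t * v) -> O (c + u, v).
Proof.
intros HC HS Heta Ht Ht' Hcc Hc' Hct Hex Hu Ho.
set (k := t' / t) in *.
assert (Hk : 0 < k) by (apply Rdiv_lt_0_compat; assumption).
assert (Hkt : k * t = t') by (unfold k; field; lra).
assert (Hku : 0 < k * u) by (apply Rmult_lt_0_compat; assumption).
clearbody k.
(* F is the absolute height of the given point of O at abscissa c' + k u. *)
pose (F := k * Rabs v). pose (D := c' - c).
assert (HF : 0 <= F) by (apply Rmult_le_pos; [lra|apply Rabs_pos]).
assert (Hox : O (c' + k * u, F)).
{ apply (vertical O _ F (k * v) HC HS Ho). right. unfold F. rewrite !Rabs_mult, Rabs_Rabsolu. reflexivity. }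
assert (HD : 0 < D) by (unfold D; lra).
assert (Hcomb : forall l, 0 <= l <= 1 ->
  O (l * c + (1 - l) * (c' + k * u), l * t + (1 - l) * F)).
{ intros l Hl. exact (HC _ _ l Hct Hox Hl). }
(* The chord from (c, t) to (c' + k u, F) passes at most at height t' over c'. Otherwise w is its
   height there. *)
assert (Hbound : k * u * t + D * F <= t' * (D + k * u)).
{ apply Rnot_lt_le; intros Hlt.
  pose (w := (k * u * t + D * F) / (D + k * u)).
  assert (Hw : t' < w).
  { apply Rmult_lt_reg_r with (D + k * u); [lra|].
    replace (w * (D + k * u)) with (k * u * t + D * F) by (unfold w; field; lra). exact Hlt. }
  assert (How : O (c', w)).
  { pose proof (Hcomb (k * u / (D + k * u))) as H.
    replace (k * u / (D + k * u) * c + (1 - k * u / (D + k * u)) * (c' + k * u)) with c' in H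
      by (unfold D; field; unfold D in *; lra).
    replace (k * u / (D + k * u) * t + (1 - k * u / (D + k * u)) * F) with w in H
      by (unfold w; field; lra).
    apply H. split; [left; apply Rdiv_lt_0_compat; lra|].
    apply Rmult_le_reg_r with (D + k * u); [lra|]. unfold Rdiv. rewrite Rmult_assoc, Rinv_l; lra. }
  clearbody w.
  pose (q := eta * w / (k * u)).
  assert (Hq : 0 < q).
  { apply Rdiv_lt_0_compat; [apply Rmult_lt_0_compat; lra|lra]. }
  (* The segment from (c', w) to the axis point (c' + k u, 0) meets the ray. Moving along it by the
     fraction l, the abscissa matches the ray at height t' + e, and e is chosen so that (1 - l) w =
     t' + e. *)
  pose (e := (w - t') / (1 + q)).
  assert (He : 0 < e) by (apply Rdiv_lt_0_compat; lra).
  assert (Heq : e * (1 + q) = w - t') by (unfold e; field; lra).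
  pose (l := eta * e / (k * u)).
  assert (Hl0 : 0 < l).
  { apply Rdiv_lt_0_compat; [apply Rmult_lt_0_compat; lra|lra]. }
  assert (Hlw : l * w = e * q) by (unfold l, q; field; lra).
  assert (Hl1 : l < 1) by nra.
  apply (Hex (t' + e)); [lra|].
  pose proof (HC _ _ (1 - l) How (axis_point O _ _ HC HS Hox) ltac:(lra)) as H. cbn [fst snd] in H.
  assert (Hlk : l * (k * u) = eta * e) by (unfold l; field; lra).
  replace ((1 - l) * c' + (1 - (1 - l)) * (c' + k * u)) with (y + eta * (t' + e)) in H.
  2:{ rewrite Hc'. replace ((1 - l) * (y + eta * t') + (1 - (1 - l)) * (y + eta * t' + k * u))
       with (y + eta * t' + l * (k * u)) by ring. rewrite Hlk. ring. }
  refine (vertical O _ _ _ HC HS H _).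
  rewrite !Rabs_right; nra. }
(* D' / (D + k u) is the weight of (c, t) that puts the chord point at abscissa c + u. Its height
   there is at least |v| exactly when D F <= k t D', a rearrangement of [Hbound] using t' = k t. *)
pose (D' := D + (k - 1) * u).
assert (HD' : D * F <= k * t * D') by (unfold D'; rewrite <- Hkt in Hbound; nra).
assert (HD0 : 0 <= D').
{ apply Rmult_le_reg_l with (k * t); [rewrite Hkt; lra|]. nra. }
pose proof (Hcomb (D' / (D + k * u))) as H.
replace (D' / (D + k * u) * c + (1 - D' / (D + k * u)) * (c' + k * u)) with (c + u) in H
  by (unfold D', D; field; unfold D in *; lra).
assert (Hl : 0 <= D' / (D + k * u) <= 1).
{ split.
  - apply Rmult_le_pos; [exact HD0|]. left; apply Rinv_0_lt_compat; lra.
  - apply Rmult_le_reg_r with (D + k * u); [lra|]. unfold Rdiv. rewrite Rmult_assoc, Rinv_l by lra.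
    unfold D'. nra. }
refine (vertical O _ _ _ HC HS (H Hl) _).
replace (D' / (D + k * u) * t + (1 - D' / (D + k * u)) * F) with ((D' * t + u * F) / (D + k * u))
  by (unfold D'; field; lra).
assert (Hge : Rabs v <= (D' * t + u * F) / (D + k * u)).
{ apply Rmult_le_reg_r with (D + k * u); [lra|].
  replace ((D' * t + u * F) / (D + k * u) * (D + k * u)) with (D' * t + u * F) by (field; lra).
  apply Rmult_le_reg_l with k; [exact Hk|].
  replace (k * (Rabs v * (D + k * u))) with (F * (D + k * u)) by (unfold F; ring). nra. }
eapply Rle_trans; [exact Hge|apply Rle_abs].
Qed.

Definition mirror (O : pt -> Prop) (p : pt) : Prop := O (- fst p, snd p).

Lemma mirror_convex O : convex_set O -> convex_set (mirror O).
Proof.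
intros HC p q t Hp Hq Ht. unfold mirror in *. cbn [fst snd] in *.
pose proof (HC _ _ t Hp Hq Ht) as H. cbn [fst snd] in H.
replace (- (t * fst p + (1 - t) * fst q)) with (t * - fst p + (1 - t) * - fst q) by ring. exact H.
Qed.

(** The previous lemma for the mirror image of O: the two exit points exchange roles and the ratio
    t'/t becomes t/t'. *)
Lemma homothety_shape_left O y eta c t c' t' u v :
  convex_set O -> xsym O -> 0 < eta -> 0 < t -> 0 < t' -> c < c' -> c = y - eta * t ->
  O (c', t') -> (forall s, t < s -> ~ O (y + - eta * s, s)) -> 0 < u ->
  O (c - u, v) -> O (c' - t' / t * u, t' / t * v).
Proof.
intros HC HS Heta Ht Ht' Hcc Hc Hct Hex Hu Ho.
assert (Hk : 0 < t' / t) by (apply Rdiv_lt_0_compat; assumption).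
pose proof (homothety_shape (mirror O) (- y) eta (- c') t' (- c) t (t' / t * u) (t' / t * v)
  (mirror_convex O HC)) as H.
replace (c' - t' / t * u) with (- (- c' + t' / t * u)) by ring.
apply H; clear H; auto; try lra.
- intros x z Hz. exact (HS _ _ Hz).
- unfold mirror; cbn [fst snd]. rewrite Ropp_involutive. exact Hct.
- intros s Hs. unfold mirror; cbn [fst snd]. replace (- (- y + eta * s)) with (y + - eta * s) by ring.
  exact (Hex s Hs).
- apply Rmult_lt_0_compat; assumption.
- unfold mirror; cbn [fst snd].
  replace (- (- c + t / t' * (t' / t * u))) with (c - u) by (field; lra).
  replace (t / t' * (t' / t * v)) with v by (field; lra). exact Ho.
Qed.

(* For y inside the axis segment, homothety Phi maps the exit point (c, t) of the left ray from
   (y, 0) to the exit point (c', t') of the right one, and q1 = (y - 2 eta t, 0) to q2 = (y, 0)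
   and q2 to Q2 = (y + 2 eta t', 0).  Since {Phi in O} shrinks O on the side where kdiff q2 q1 is
   positive and enlarges it on the other side, an increase of spot from q2 to Q2 forces one
   from q1 to q2. *)
Lemma no_local_min O alpha a b y d : 1 < alpha < 3 -> convex_body O -> xsym O ->
  O (a, 0) -> O (b, 0) -> (forall z, O z -> a <= fst z <= b) -> a < y < b -> 0 < d ->
  ~ (forall p, Rabs (p - y) < d -> spot O alpha (y, 0) <= spot O alpha (p, 0)).
Proof.
intros Ha HO HS Hoa Hob Hab Hy Hd Hmin. pose proof HO as [HC [Hc [Hb _]]].
destruct (bounded_in_box O Hb) as [B [HB HOB]].
pose proof (axis_interior O a b y HO HS Hoa Hob Hy) as Hint.
(* Exit heights are below B, so 2 eta t and 2 eta t' stay below d and both comparison points are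
   within d of y. *)
pose (eta := d / (2 * B)).
assert (Heta : 0 < eta) by (apply Rdiv_lt_0_compat; lra).
assert (HetaB : eta * B = d / 2) by (unfold eta; field; lra).
clearbody eta.
destruct (ray_exit O y eta B Hc HOB Hint) as [t' [[Ht' Ht'B] [Ho' Hex']]].
destruct (ray_exit O y (- eta) B Hc HOB Hint) as [t [[Ht HtB] [Ho Hex]]].
pose (c := y - eta * t). pose (c' := y + eta * t').
assert (Et : 0 < eta * t) by (apply Rmult_lt_0_compat; lra).
assert (Et' : 0 < eta * t') by (apply Rmult_lt_0_compat; lra).
assert (Hcc : c < c') by (unfold c, c'; lra).
assert (Ho1 : O (c, t)) by (unfold c; replace (y - eta * t) with (y + - eta * t) by ring; exact Ho).
fold c' in Ho'.
pose proof (Hab _ Ho1) as Hc1. pose proof (Hab _ Ho') as Hc2. cbn [fst] in Hc1, Hc2.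
pose (k := t' / t).
assert (Hk : 0 < k) by (apply Rdiv_lt_0_compat; lra).
assert (Hkt : k * t = t') by (unfold k; field; lra).
assert (Hket : k * (eta * t) = eta * t') by (rewrite <- Hkt; ring).
assert (shapeR : forall u v, 0 < u -> O (c' + k * u, k * v) -> O (c + u, v)).
{ intros u v. apply (homothety_shape O y eta c t c' t' u v); auto. }
assert (shapeL : forall u v, 0 < u -> O (c - u, v) -> O (c' - k * u, k * v)).
{ intros u v. apply (homothety_shape_left O y eta c t c' t' u v); auto. }
clearbody k.
(* Written from c to c' rather than about a fixed point, so that k = 1, a translation, needs no
   separate treatment. *)
pose (Phi := fun z : pt => (c' + k * (fst z - c), k * snd z)).
pose (q1 := (y - 2 * (eta * t), 0)). pose (q2 := (y, 0)). pose (Q2 := (y + 2 * (eta * t'), 0)).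
assert (D1 : forall z, dist2 (Phi z) q2 = k * dist2 z q1).
{ intros z. rewrite (dist2_homothety k z q1).
  - rewrite Rabs_right by lra. reflexivity.
  - unfold Phi, q1, q2; cbn [fst snd]. unfold c, c'. lra.
  - unfold Phi, q1, q2; cbn [fst snd]. ring. }
assert (D2 : forall z, dist2 (Phi z) Q2 = k * dist2 z q2).
{ intros z. rewrite (dist2_homothety k z q2).
  - rewrite Rabs_right by lra. reflexivity.
  - unfold Phi, q2, Q2; cbn [fst snd]. unfold c, c'. lra.
  - unfold Phi, q2, Q2; cbn [fst snd]. ring. }
assert (HPhi : scales (/ Rabs k * / Rabs k) Phi).
{ refine (scales_eq _ _ _ _ (scales_diag (c' - k * c) 0 k k ltac:(lra) ltac:(lra))).
  intros z; unfold Phi; f_equal; ring. }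
destruct (spot_diff O alpha Q2 q2 Ha Hc Hb) as [sg eg].
destruct (spot_diff O alpha q2 q1 Ha Hc Hb) as [sh eh].
destruct (int_change HPhi sg) as [sgP egP].
pose (rho := Rpower k (alpha - 2)).
assert (Hrho : 0 < rho) by apply exp_pos.
destruct (int_scal rho sh) as [srh erh].
destruct (int_minus srh sgP) as [sf ef].
assert (G0 : 0 <= spot O alpha Q2 - spot O alpha q2).
{ unfold Q2, q2. pose proof (Hmin (y + 2 * (eta * t'))) as H.
  replace (y + 2 * (eta * t') - y) with (2 * (eta * t')) in H by ring.
  rewrite Rabs_right in H by lra. specialize (H ltac:(nra)). lra. }
assert (H0 : spot O alpha q2 - spot O alpha q1 <= 0).
{ unfold q1, q2. pose proof (Hmin (y - 2 * (eta * t))) as H.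
  replace (y - 2 * (eta * t) - y) with (- (2 * (eta * t))) in H by ring.
  rewrite Rabs_Ropp, Rabs_right in H by lra. specialize (H ltac:(nra)). lra. }
rewrite erh, eh, egP, eg in ef.
set (f := fun p => _ - _) in sf, ef.
assert (Hle : int2 f <= 0).
{ rewrite ef. rewrite Rabs_right by lra.
  assert (0 <= / k * / k * (spot O alpha Q2 - spot O alpha q2)).
  { apply Rmult_le_pos; [|exact G0]. pose proof (Rinv_0_lt_compat _ Hk). nra. }
  nra. }
assert (Hf : forall z, ~ (z = q1 \/ z = q2) ->
  f z = rho * ((charf (O z) - charf (O (Phi z))) * kdiff alpha q2 q1 z)).
{ intros z Hz. unfold f.
  (* Pulling back by Phi brings the comparison of Q2 with q2 to the same [kdiff] as that of q2 with
     q1; only the indicators differ. *)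
  assert (E : kdiff alpha Q2 q2 (Phi z) = rho * kdiff alpha q2 q1 z).
  { unfold kdiff. rewrite D1, D2.
    assert (P1 : 0 < dist2 z q1).
    { destruct (dist2_pos z q1) as [h|h]; [exact h|]. exfalso. apply Hz; left. apply dist2_eq0; auto. }
    assert (P2 : 0 < dist2 z q2).
    { destruct (dist2_pos z q2) as [h|h]; [exact h|]. exfalso. apply Hz; right. apply dist2_eq0; auto. }
    rewrite (kern_scaling alpha k _ _ Hk P2 P1). fold rho. ring. }
  rewrite E. ring. }
(* The midpoint of q1 and q2 has abscissa c, so their bisector is the vertical line through the left
   exit point, where the two shape inclusions change direction. *)
assert (Hsq : forall z, sqd z q1 - sqd z q2 = 4 * (eta * t) * (fst z - c)).
{ intros z. unfold sqd, q1, q2, c; cbn [fst snd]. ring. }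
assert (Kpos : forall z, ~ (z = q1 \/ z = q2) -> c < fst z -> 0 < kdiff alpha q2 q1 z).
{ intros z Hz Hlt. apply kdiff_pos; [tauto|]. specialize (Hsq z). nra. }
assert (Kneg : forall z, ~ (z = q1 \/ z = q2) -> fst z < c -> kdiff alpha q2 q1 z < 0).
{ intros z Hz Hlt. apply kdiff_neg; [tauto|]. specialize (Hsq z). nra. }
assert (Hbox : exists z0 e, 0 < e /\ forall z, dist2 z0 z < e ->
  (c < fst z /\ O z /\ ~ O (Phi z)) \/ (fst z < c /\ ~ O z /\ O (Phi z))).
(* [be] is the right end of the preimage of O under Phi, and [ga] the image of the left end a. If be
   < b, a strip near b lies in O only; if a < ga, points left of a are mapped into O. If neither
   holds, c < c' forces k < 1 on the right and k > 1 on the left, a contradiction. *)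
{ pose (be := c + (b - c') / k). pose (ga := c' + k * (a - c)).
  assert (Hbe : k * (be - c) = b - c') by (unfold be; field; lra).
  destruct (Rlt_le_dec be b) as [L|L].
  - pose (m := Rmax be c). pose proof (Rmax_l be c) as M1. pose proof (Rmax_r be c) as M2.
    assert (Hm : m < b) by (apply Rmax_lub_lt; lra). fold m in M1, M2.
    pose (x0 := (m + b) / 2).
    destruct (axis_interior O a b x0 HO HS Hoa Hob ltac:(unfold x0; lra)) as [e [He Hi]].
    exists (x0, 0), (Rmin e (x0 - m)). split; [apply Rmin_pos; unfold x0; lra|].
    intros z Hz. pose proof (Rmin_l e (x0 - m)). pose proof (Rmin_r e (x0 - m)).
    destruct (dist2_small_comp _ _ _ Hz) as [Hz1 _]. cbn [fst snd] in Hz1. apply Rabs_def2 in Hz1.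
    left. split; [lra|]. split; [apply Hi; lra|].
    intros HP. apply Hab in HP. unfold Phi in HP; cbn [fst] in HP.
    assert (k * (be - c) < k * (fst z - c)) by (apply Rmult_lt_compat_l; lra). lra.
  - destruct (Rlt_le_dec a ga) as [L2|L2].
    + assert (Hgac : ga <= c').
      { unfold ga. assert (0 <= k * (c - a)) by (apply Rmult_le_pos; lra). lra. }
      pose (x1 := (a + ga) / 2).
      destruct (axis_interior O a b x1 HO HS Hoa Hob ltac:(unfold x1; lra)) as [e [He Hi]].
      exists (c + (x1 - c') / k, 0), (Rmin (e / k) ((ga - x1) / k)).
      split; [apply Rmin_pos; apply Rdiv_lt_0_compat; unfold x1; lra|].
      intros z Hz. pose proof (Rmin_l (e / k) ((ga - x1) / k)) as R1.
      pose proof (Rmin_r (e / k) ((ga - x1) / k)) as R2.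
      destruct (dist2_small_comp _ _ _ Hz) as [Hz1 _]. cbn [fst snd] in Hz1. apply Rabs_def2 in Hz1.
      assert (Hza : fst z < a).
      { apply Rlt_le_trans with (c + (x1 - c') / k + (ga - x1) / k); [lra|].
        right. unfold ga. field. lra. }
      right. split; [lra|]. split; [intros h; apply Hab in h; lra|].
      apply Hi. rewrite (dist2_homothety k (c + (x1 - c') / k, 0) z).
      * rewrite Rabs_right by lra. apply Rmult_lt_reg_l with (/ k); [apply Rinv_0_lt_compat; lra|].
        rewrite <- Rmult_assoc, Rinv_l, Rmult_1_l by lra. unfold Rdiv in R1. lra.
      * unfold Phi; cbn [fst snd]. field; lra.
      * unfold Phi; cbn [fst snd]. ring.
    + exfalso. unfold ga in L2.
      assert (k * (b - c) <= k * (be - c)) by (apply Rmult_le_compat_l; lra).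
      destruct (Rlt_le_dec k 1) as [K|K].
      * assert (k * (c - a) <= 1 * (c - a)) by (apply Rmult_le_compat_r; lra). lra.
      * assert (1 * (b - c) <= k * (b - c)) by (apply Rmult_le_compat_r; lra). lra. }
destruct Hbox as [z0 [e [He Hz0]]].
enough (0 < int2 f) by lra.
apply (int_gt0_near f (fun z => z = q1 \/ z = q2) z0 e sf).
- apply null_or; apply null_point.
- intros z Hz. rewrite (Hf z Hz). apply Rmult_le_pos; [lra|].
  destruct (Rtotal_order (fst z) c) as [L|[L|L]].
  + pose proof (Kneg z Hz L).
    assert (charf (O z) <= charf (O (Phi z))).
    { apply charf_le. intros h. pose proof (shapeL (c - fst z) (snd z) ltac:(lra)) as K.
      replace (c - (c - fst z)) with (fst z) in K by ring. rewrite <- surjective_pairing in K.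
      unfold Phi. replace (c' + k * (fst z - c)) with (c' - k * (c - fst z)) by ring. auto. }
    nra.
  + rewrite kdiff_0; [lra|]. specialize (Hsq z). rewrite L in Hsq. lra.
  + pose proof (Kpos z Hz L).
    assert (charf (O (Phi z)) <= charf (O z)).
    { apply charf_le. intros h. pose proof (shapeR (fst z - c) (snd z) ltac:(lra)) as K.
      replace (c + (fst z - c)) with (fst z) in K by ring. rewrite <- surjective_pairing in K.
      auto. }
    nra.
- exact He.
- intros z Hz Hn. rewrite (Hf z Hn). apply Rmult_lt_0_compat; [exact Hrho|].
  destruct (Hz0 z Hz) as [[h1 [h2 h3]]|[h1 [h2 h3]]]; rewrite (charfT h2) || rewrite (charfF h2);
    rewrite (charfF h3) || rewrite (charfT h3).
  + pose proof (Kpos z Hn h1). lra.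
  + pose proof (Kneg z Hn h1). lra.
Qed.

(** * Centers *)

Lemma is_centerE O alpha x : 1 < alpha < 3 -> convex_body O ->
  is_center O alpha x <-> forall y, spot O alpha y <= spot O alpha x.
Proof.
intros Ha HO. unfold spot, ksign. split.
- intros [v [Hv Hmax]] y. apply (V_isE O alpha x v Ha HO) in Hv. subst v.
  destruct (Hmax y (pot O alpha y)) as [h1 h2]; [apply V_isE; auto|].
  destruct (Rle_dec alpha 2) as [h|h]; [pose proof (h1 h)|pose proof (h2 ltac:(lra))]; lra.
- intros H. exists (pot O alpha x). split; [apply V_isE; auto|].
  intros y w Hw. apply (V_isE O alpha y w Ha HO) in Hw. subst w. specialize (H y).
  destruct (Rle_dec alpha 2) as [h|h]; split; intros; lra.
Qed.

Lemma spot_axis_continuity O alpha : 1 < alpha < 3 -> convex_body O ->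
  forall r, continuity_pt (fun p => spot O alpha (p, 0)) r.
Proof.
intros Ha HO r eps Heps.
destruct (pot_continuity O alpha (r, 0) eps Ha HO Heps) as [d [Hd H]].
exists d. split; [exact Hd|]. intros p [_ Hp]. simpl in Hp |- *. unfold Rdist in *.
unfold spot. rewrite <- Rmult_minus_distr_l, Rabs_mult.
replace (Rabs (ksign alpha)) with 1.
- rewrite Rmult_1_l. apply H. eapply Rle_lt_trans; [apply dist2_le|]. cbn [fst snd].
  rewrite (Rabs_minus_sym r), Rminus_diag, Rabs_R0. lra.
- unfold ksign. destruct (Rle_dec alpha 2); [rewrite Rabs_R1|rewrite Rabs_left by lra]; lra.
Qed.

Lemma symmetric_unique_max O alpha : 1 < alpha < 3 -> convex_body O -> xsym O ->
  exists m, (forall y, spot O alpha y <= spot O alpha (m, 0)) /\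
    forall x, (forall y, spot O alpha y <= spot O alpha x) -> x = (m, 0).
Proof.
intros Ha HO HS.
destruct (axis_end O 1 HO HS ltac:(ring)) as [b [Hob Hb]].
destruct (axis_end O (-1) HO HS ltac:(ring)) as [a' [Hoa Ha']].
pose (a := -1 * a'). fold a in Hoa. rewrite Rmult_1_l in Hob.
assert (Hab : forall z, O z -> a <= fst z <= b).
{ intros z Hz. pose proof (Hb z Hz). pose proof (Ha' z Hz). unfold a. lra. }
assert (Hle : a <= b) by exact (proj2 (Hab _ Hoa)).
pose (W := fun p => spot O alpha (p, 0)).
assert (HW : forall r, continuity_pt W r) by exact (spot_axis_continuity O alpha Ha HO).
assert (Hout : forall p, ~ (a <= p <= b) -> exists q, a <= q <= b /\ W p < W q).
{ intros p Hp. destruct (Rlt_le_dec b p) as [L|L].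
  - exists b. split; [lra|]. pose proof (spot_outside O alpha 1 b p Ha HO ltac:(ring) Hb ltac:(lra)) as H.
    rewrite Rmult_1_l in H. exact H.
  - exists a. split; [lra|].
    exact (spot_outside O alpha (-1) a' p Ha HO ltac:(ring) Ha' ltac:(unfold a in Hp; lra)). }
assert (Hoff : forall p q, q <> 0 -> spot O alpha (p, q) < W p).
{ intros p q Hq. apply spot_off_axis; assumption. }
destruct (continuity_ab_maj W a b Hle (fun r _ => HW r)) as [m [Hm1 Hm2]].
assert (Hmax : forall y, spot O alpha y <= spot O alpha (m, 0)).
{ assert (HmW : forall p, W p <= W m).
  { intros p. destruct (excluded_middle_informative (a <= p <= b)) as [h|h]; [auto|].
    destruct (Hout p h) as [q [Hq Hlt]]. pose proof (Hm1 q Hq). lra. }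
  intros [p q]. destruct (Req_dec q 0) as [->|ne]; [exact (HmW p)|].
  pose proof (Hoff p q ne). pose proof (HmW p). unfold W in *. lra. }
exists m. split; [exact Hmax|].
assert (Huniq : forall r s, a <= r -> s <= b -> r < s -> W r = W m -> W s = W m -> False).
{ intros r s Hr Hs Hrs er es.
  destruct (continuity_ab_min W r s ltac:(lra) (fun u _ => HW u)) as [n [Hn1 Hn2]].
  assert (Hmin : exists y, r < y < s /\ forall u, r <= u <= s -> W y <= W u).
  (* If the minimum over [r, s] equals the maximum, W is constant there and the midpoint is a weak
     local minimum. Otherwise the minimum is attained away from r and s. *)
  { destruct (Req_dec (W n) (W m)) as [e|ne].
    - exists ((r + s) / 2). split; [lra|]. intros u Hu.
      pose proof (Hn1 u Hu). pose proof (Hmax ((r + s) / 2, 0)). unfold W in *. lra.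
    - exists n. split; [|exact Hn1].
      destruct Hn2 as [[h1|h1] [h2|h2]]; subst; try lra; exfalso; auto. }
  destruct Hmin as [y [Hy Hyu]].
  apply (no_local_min O alpha a b y (Rmin (y - r) (s - y)) Ha HO HS Hoa Hob Hab ltac:(lra)).
  - apply Rmin_pos; lra.
  - intros p Hp. pose proof (Rmin_l (y - r) (s - y)). pose proof (Rmin_r (y - r) (s - y)).
    apply Rabs_def2 in Hp. apply Hyu. lra. }
intros [p q] Hx.
assert (q = 0).
{ apply NNPP; intros ne. pose proof (Hoff p q ne). pose proof (Hx (p, 0)). unfold W in *. lra. }
subst q.
assert (Hp : a <= p <= b).
{ apply NNPP; intros h. destruct (Hout p h) as [q [_ Hq]]. pose proof (Hx (q, 0)). unfold W in *. lra. }
assert (e : W p = W m) by (pose proof (Hx (m, 0)); pose proof (Hmax (p, 0)); unfold W; lra).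
destruct (Rtotal_order p m) as [L|[->|L]]; [|reflexivity|]; exfalso.
- exact (Huniq p m ltac:(lra) ltac:(lra) L e ltac:(reflexivity)).
- exact (Huniq m p ltac:(lra) ltac:(lra) L ltac:(reflexivity) e).
Qed.

(* The frame with origin p0 whose first axis has direction (C, S). *)
Definition frame (C S : R) (p0 p : pt) : pt :=
  (fst p0 + fst p * C - snd p * S, snd p0 + fst p * S + snd p * C).

Definition unframe (C S : R) (p0 p : pt) : pt :=
  ((fst p - fst p0) * C + (snd p - snd p0) * S, (snd p - snd p0) * C - (fst p - fst p0) * S).

Lemma frame_unframe C S p0 p : C * C + S * S = 1 -> frame C S p0 (unframe C S p0 p) = p.
Proof.
intros H. destruct p as [x y]. unfold frame, unframe; cbn [fst snd]. f_equal.
- replace (fst p0 + ((x - fst p0) * C + (y - snd p0) * S) * C - ((y - snd p0) * C - (x - fst p0) * S) * S)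
    with (fst p0 + (x - fst p0) * (C * C + S * S)) by ring. rewrite H; ring.
- replace (snd p0 + ((x - fst p0) * C + (y - snd p0) * S) * S + ((y - snd p0) * C - (x - fst p0) * S) * C)
    with (snd p0 + (y - snd p0) * (C * C + S * S)) by ring. rewrite H; ring.
Qed.

Lemma frame_dist C S p0 p q : C * C + S * S = 1 -> dist2 (frame C S p0 p) (frame C S p0 q) = dist2 p q.
Proof.
intros H. unfold dist2. f_equal. unfold frame; cbn [fst snd].
set (u := fst p - fst q). set (v := snd p - snd q).
replace (fst p0 + fst p * C - snd p * S - (fst p0 + fst q * C - snd q * S)) with (u * C - v * S)
  by (unfold u, v; ring).
replace (snd p0 + fst p * S + snd p * C - (snd p0 + fst q * S + snd q * C)) with (u * S + v * C)
  by (unfold u, v; ring).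
replace ((u * C - v * S) ^ 2 + (u * S + v * C) ^ 2) with ((u ^ 2 + v ^ 2) * (C * C + S * S)) by ring.
rewrite H. ring.
Qed.

Lemma frame_reflect p0 th x y : reflect p0 th (frame (cos th) (sin th) p0 (x, y)) =
  frame (cos th) (sin th) p0 (x, - y).
Proof.
pose proof (sin2_cos2 th) as H. unfold Rsqr in H. rewrite Rplus_comm in H.
unfold reflect, frame; cbn [fst snd]. set (C := cos th) in *. set (S := sin th) in *. clearbody C S.
replace ((fst p0 + x * C - y * S - fst p0) * C + (snd p0 + x * S + y * C - snd p0) * S)
  with (x * (C * C + S * S)) by ring.
rewrite H. f_equal; ring.
Qed.

(** A positive factor suffices to preserve the order between potentials, and it comes directly from
    a factorization into shears and a swap. That factorization divides by S, hence the separate case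
    S = 0. *)
Lemma frame_scales C S p0 : C * C + S * S = 1 -> exists c, 0 < c /\ scales c (frame C S p0).
Proof.
intros HCS. destruct (Req_dec S 0) as [e|ne].
- assert (HC : C <> 0) by (intros h; rewrite e, h in HCS; lra).
  pose proof (Rinv_0_lt_compat _ (Rabs_pos_lt C HC)).
  exists (/ Rabs C * / Rabs C). split; [nra|].
  refine (scales_eq _ _ _ _ (scales_diag (fst p0) (snd p0) C C HC HC)).
  intros p. unfold frame. rewrite e. f_equal; ring.
- (* frame = B o swap o A with shears A : (x, y) |-> (x, X) and B : (X, x) |-> (X, Y),
     where (X, Y) = frame (x, y) *)
  assert (HmS : - S <> 0) by lra.
  assert (HiS : / S <> 0) by (apply Rinv_neq_0_compat; exact ne).
  pose proof (scales_comp (scales_shear (- (C / S)) (snd p0 + C / S * fst p0) HiS)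
    (scales_comp scales_swap (scales_shear C (fst p0) HmS))) as H.
  eexists; split; [|refine (scales_eq _ _ _ _ H)].
  + pose proof (Rinv_0_lt_compat _ (Rabs_pos_lt _ HmS)).
    pose proof (Rinv_0_lt_compat _ (Rabs_pos_lt _ HiS)). nra.
  + intros p. unfold frame; cbn [fst snd]. f_equal; [ring|].
    replace (- (C / S) * (C * fst p + fst p0 + - S * snd p) + (snd p0 + C / S * fst p0) + / S * fst p)
      with (snd p0 + fst p * ((1 - C * C) / S) + snd p * C) by (field; exact ne).
    replace (1 - C * C) with (S * S) by lra. field; exact ne.
Qed.

Lemma frame_body C S p0 O : C * C + S * S = 1 -> convex_body O -> convex_body (fun p => O (frame C S p0 p)).
Proof.
intros H0 [HC [Hc [[M HM] [q [e [He Hq]]]]]]. split; [|split; [|split]].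
- intros u v t Hu Hv Ht. pose proof (HC _ _ t Hu Hv Ht) as H.
  replace (frame C S p0 (t * fst u + (1 - t) * fst v, t * snd u + (1 - t) * snd v)) with
    (t * fst (frame C S p0 u) + (1 - t) * fst (frame C S p0 v), t * snd (frame C S p0 u) + (1 - t) * snd (frame C S p0 v)); [exact H|].
  unfold frame; cbn [fst snd]; f_equal; ring.
- intros p Hp. destruct (Hc _ Hp) as [d [Hd H]]. exists d. split; [exact Hd|].
  intros r Hr. apply H. rewrite (frame_dist C S p0) by exact H0. exact Hr.
- exists (M + dist2 (0, 0) (frame C S p0 (0, 0))). intros p Hp. rewrite <- (frame_dist C S p0) by exact H0.
  pose proof (dist2_tri (frame C S p0 p) (0, 0) (frame C S p0 (0, 0))). pose proof (HM _ Hp). lra.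
- exists (unframe C S p0 q), e. split; [exact He|]. intros r Hr. apply Hq.
  rewrite <- (frame_unframe C S p0 q H0), (frame_dist C S p0) by exact H0. exact Hr.
Qed.

Lemma frame_spot C S p0 O alpha : C * C + S * S = 1 -> 1 < alpha < 3 -> convex_body O ->
  exists c, 0 < c /\
    forall x, spot (fun p => O (frame C S p0 p)) alpha x = c * spot O alpha (frame C S p0 x).
Proof.
intros H0 Ha [_ [Hc [Hb _]]]. destruct (frame_scales C S p0 H0) as [c [Hcp Hs]].
exists c. split; [exact Hcp|].
intros x. destruct (pot_translated O alpha (frame C S p0 x) Ha Hc Hb) as [_ [s _]].
destruct (int_change Hs s) as [_ e]. unfold spot, pot.
assert (E : (fun z => charf (O (frame C S p0 z)) * kern alpha (dist2 z x)) =
  (fun p => charf (O (frame C S p0 p)) * kern alpha (dist2 (frame C S p0 p) (frame C S p0 x)))).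
{ apply funext; intros z. rewrite frame_dist by exact H0. reflexivity. }
rewrite E, e. ring.
Qed.

Theorem theorem5p3 :
  forall O : pt -> Prop,
    convex_body O -> piecewise_C1_boundary O -> axially_symmetric O ->
    forall alpha : R, 1 < alpha < 3 ->
      exists! x : pt, is_center O alpha x.
Proof.
intros O HO _ [p0 [th Hsym]] alpha Ha.
assert (HCS : cos th * cos th + sin th * sin th = 1).
{ pose proof (sin2_cos2 th) as H. unfold Rsqr in H. lra. }
destruct (frame_spot (cos th) (sin th) p0 O alpha HCS Ha HO) as [c [Hc Hspot]].
destruct (symmetric_unique_max (fun p => O (frame (cos th) (sin th) p0 p)) alpha Ha
  (frame_body _ _ p0 O HCS HO)) as [m [Hm Hu]].
{ intros x y H. rewrite <- frame_reflect. exact (proj1 (Hsym _) H). }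
exists (frame (cos th) (sin th) p0 (m, 0)). split.
- apply is_centerE; auto. intros y. specialize (Hm (unframe (cos th) (sin th) p0 y)).
  rewrite !Hspot, frame_unframe in Hm by exact HCS. apply Rmult_le_reg_l in Hm; assumption.
- intros x Hx. pose proof (proj1 (is_centerE O alpha x Ha HO) Hx) as Hx2.
  rewrite <- (frame_unframe (cos th) (sin th) p0 x HCS). f_equal. symmetry. apply Hu.
  intros y. rewrite !Hspot, frame_unframe by exact HCS.
  apply Rmult_le_compat_l; [lra|apply Hx2].
Qed.
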